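(* Let $x\in M$. If $X_0=x$, then the support of the law of $(X_t)_{t\geq 0}$, viewed as a random element of $\mathcal C(\mathbb R_+,\mathbb R^d)$, equals $S^x$.
   Context: Setting. Let $d\ge 1$ and let $E$ be a finite set. For each $i\in E$, $F^i:\mathbb R^d\to\mathbb R^d$ is a smooth bounded vector field with flow $\Phi^i=(\Phi^i_t)$, i.e. $t\mapsto \Phi^i_t(x)=\Phi^i(t,x)$ solves $\dot x=F^i(x)$ with value $x$ at time $0$. $M\subset\mathbb R^d$ is a compact set with $\Phi^i_t(M)\subset M$ for all $i\in E$, $t\ge 0$. Rates $\lambda(x,i,j)$ ($x\in M$, $i,j\in E$) are given such that $x\mapsto\lambda(x,i,j)$ is continuous, $\lambda(x,i,j)\ge 0$ for $i\ne j$, $\lambda(x,i,i)=0$, and for each $x\in M$ the matrix $(\lambda(x,i,j))_{i,j}$ is irreducible. Fix $\lambda>\max_{x\in M,i\in E}\sum_{j\ne i}\lambda(x,i,j)$ and put $Q(x,i,j)=\lambda(x,i,j)/\lambda$ for $i\neq j$, $Q(x,i,i)=1-\sum_{j\ne i}Q(x,i,j)>0$. Process. Let $(N_t)$ be a homogeneous Poisson process of intensity $\lambda$ with jump times $(T_n)$ ($T_0=0$) and interarrival times $(U_n)$, and let $\tilde Z_0=(\tilde X_0,\tilde Y_0)\in M\times E$ be independent of $(N_t)$. Define recursively the chain $\tilde Z_n=(\tilde X_n,\tilde Y_n)$ on $M\times E$ by $\tilde X_{n+1}=\Phi^{\tilde Y_n}(U_{n+1},\tilde X_n)$ and $\mathbb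 P[\tilde Y_{n+1}=j\mid \tilde X_{n+1},\tilde Y_n=i]=Q(\tilde X_{n+1},i,j)$. Set $Z_t=(X_t,Y_t)=(\Phi^{\tilde Y_n}(t-T_n,\tilde X_n),\tilde Y_n)$ for $t\in[T_n,T_{n+1})$. Differential inclusion. For $x\in\mathbb R^d$ let $\mathrm{co}(F)(x)=\{\sum_{i\in E}\alpha_iF^i(x):\alpha_i\ge 0,\ \sum_i\alpha_i=1\}$. $\mathcal C(\mathbb R_+,\mathbb R^d)$ is the set of continuous paths $\mathbb R_+\to\mathbb R^d$ with the topology of uniform convergence on compact intervals. $S^x\subset\mathcal C(\mathbb R_+,\mathbb R^d)$ is the set of absolutely continuous $\eta$ with $\eta(0)=x$ and $\dot\eta(t)\in\mathrm{co}(F)(\eta(t))$ for almost all $t\in\mathbb R_+$. *)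

(* Defs.v *)
From HB Require Import structures.
From mathcomp Require Import all_boot all_order all_algebra.
From mathcomp Require Import all_classical all_reals all_analysis.

Set Implicit Arguments.
Unset Strict Implicit.
Unset Printing Implicit Defensive.

Import Order.TTheory GRing.Theory Num.Theory.
Import numFieldNormedType.Exports.

Local Open Scope classical_set_scope.
Local Open Scope ring_scope.

Fixpoint Ck {R : realType} {V W : normedModType R} (k : nat) (f : V -> W) :
    Prop :=
  if k is k'.+1 then
    (forall x, differentiable f x) /\ (forall v, Ck k' ('D_v f))
  else continuous f.

Definition smooth {R : realType} {V W : normedModType R} (f : V -> W) :=
  forall k, Ck k f.

Definition is_flow {R : realType} {V : normedModType R}
    (f : V -> V) (phi : R -> V -> V) :=
  (forall x, phi 0 x = x) /\
  (forall (t : R) (x : V), is_derive t 1 (phi ^~ x) (f (phi t x))).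

Definition convexified {R : realType} {V : lmodType R} {E : finType}
    (F : E -> V -> V) (x : V) : set V :=
  [set v | exists a : E -> R, [/\ forall i, 0 <= a i, \sum_i a i = 1 &
     v = \sum_i a i *: F i x]].

(* Irreducibility of a matrix with nonnegative off-diagonal entries: its graph
   of positive entries is strongly connected. *)
Definition irreducible {R : realType} {E : finType} (q : E -> E -> R) :=
  forall i j, connect [rel k l | 0 < q k l] i j.

Definition jump_prob {R : realType} {V : Type} {E : finType}
    (rate : V -> E -> E -> R) (lam : R) (x : V) (i j : E) : R :=
  if i == j then 1 - \sum_(k | k != i) rate x i k / lam else rate x i j / lam.

Definition time (R : realType) : Type := [set t : R | 0 <= t].

HB.instance Definition _ (R : realType) := Choice.on (time R).
HB.instance Definition _ (R : realType) := Topological.on (time R).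

Definition time0 {R : realType} : time R :=
  exist _ (0 : R) (mem_set (lexx (0 : R) : [set t : R | 0 <= t] 0)).

Definition cpath (R : realType) (d : nat) : Type :=
  continuousType (time R) 'rV[R]_d.

HB.instance Definition _ (R : realType) (d : nat) := Choice.on (cpath R d).
HB.instance Definition _ (R : realType) (d : nat) :=
  Uniform.copy (cpath R d) (initial_topology
    (id : continuousType (time R) 'rV[R]_d ->
          {family compact, time R -> 'rV[R]_d})).
HB.instance Definition _ (R : realType) (d : nat) :=
  isPointed.Build (cpath R d)
    (mkcts (fun x : time R => @cst_continuous (time R) 'rV[R]_d 0 x)).

Definition borel_cpath (R : realType) (d : nat) :=
  g_sigma_algebraType (@open (cpath R d)).

Definition measure_support {R : realType} {T : topologicalType}
    (mu : set T -> \bar R) : set T :=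
  [set x | forall A, open A -> A x -> (0 < mu A)%E].

(* Extension of a path to the whole line, constant on negative times. *)
Definition extend_path {R : realType} {V : Type} (eta : time R -> V) (t : R) : V :=
  eta (insubd time0 t).

Definition abs_continuous {R : realType} {V : normedModType R} (a b : R)
    (f : R -> V) :=
  forall e, 0 < e -> exists2 delta, 0 < delta &
    forall (n : nat) (l r : 'I_n -> R),
      (forall i, [/\ a <= l i, l i <= r i & r i <= b]) ->
      trivIset setT (fun i => `]l i, r i[%classic) ->
      \sum_i (r i - l i) < delta -> \sum_i `|f (r i) - f (l i)| < e.

Definition inclusion_solutions {R : realType} {d : nat} {E : finType}
    (F : E -> 'rV[R]_d -> 'rV[R]_d) (x : 'rV[R]_d) : set (cpath R d) :=
  [set eta | [/\ forall b, 0 <= b -> abs_continuous 0 b (extend_path eta),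
     eta time0 = x &
     {ae lebesgue_measure, forall t : R, 0 <= t ->
        exists2 v, convexified F (extend_path eta t) v &
                   is_derive t 1 (extend_path eta) v}]].

Definition interarrival {R : realType} {Omega : Type} (T : nat -> Omega -> R)
    (n : nat) (w : Omega) : R := T n.+1 w - T n w.

(* A homogeneous Poisson process N of intensity lam with jump times T, as the
   counting process of a renewal sequence with i.i.d. exponential interarrival
   times; interarrival T n is the (n+1)-st of them. *)
Record poisson_process {R : realType} {disp : measure_display}
    {Omega : measurableType disp} (P : probability Omega R) (lam : R)
    (N : time R -> Omega -> nat) (T : nat -> Omega -> R) : Prop := {
  jump_time0 : forall w, T 0 w = 0 ;
  jump_time_lt : forall n w, T n w < T n.+1 w ;
  countingP : forall (t : time R) n w,
    N t w = n <-> T n w <= \val t < T n.+1 w ;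
  measurable_interarrival : forall n, measurable_fun setT (interarrival T n) ;
  interarrival_law : forall n (A : set R), measurable A ->
    P (interarrival T n @^-1` A) = exponential_prob lam A ;
  interarrival_indep : forall n (A : 'I_n -> set R),
    (forall k, measurable (A k)) ->
    P (\bigcap_(k : 'I_n) (interarrival T k @^-1` A k)) =
    (\prod_(k < n) P (interarrival T k @^-1` A k))%E }.

(* Product of the Borel sigma-algebra of R^d and the discrete one on E. *)
Definition state_measurable {R : realType} {d : nat} {E : finType} :
    set (set ('rV[R]_d * E)) :=
  [set A | forall i : E, <<s @open 'rV[R]_d >> [set x | A (x, i)]].

Definition sigma_counting {R : realType} {Omega : Type}
    (N : time R -> Omega -> nat) : set (set Omega) :=
  <<s \bigcup_t preimage_set_system setT (N t) measurable >>.

(* The sigma-algebra generated by Z_0, ..., Z_n and the whole process N. *)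
Definition sigma_past {R : realType} {d : nat} {E : finType} {Omega : Type}
    (N : time R -> Omega -> nat) (Z : nat -> Omega -> 'rV[R]_d * E) (n : nat) :
    set (set Omega) :=
  <<s (\bigcup_(k in [set k | (k <= n)%N])
         preimage_set_system setT (Z k) state_measurable)
      `|` sigma_counting N >>.

(* In embedded_law the clause
     P[Y_(n+1) = j | Z_0, ..., Z_n, N] = Q(X_(n+1), Y_n, j)
   is spelled out by integrating over the events of the conditioning
   sigma-algebra: in particular the next mode depends on the past, and on the
   Poisson process, only through X_(n+1) and Y_n. *)
Record embedded_chain {R : realType} {d : nat} {E : finType}
    {disp : measure_display} {Omega : measurableType disp}
    (P : probability Omega R) (Phi : E -> R -> 'rV[R]_d -> 'rV[R]_d)
    (M : set 'rV[R]_d) (Q : 'rV[R]_d -> E -> E -> R)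
    (N : time R -> Omega -> nat) (T : nat -> Omega -> R)
    (Z : nat -> Omega -> 'rV[R]_d * E) : Prop := {
  embedded_measurable : forall n A, state_measurable A ->
    measurable (Z n @^-1` A) ;
  embedded_init : forall w, M (Z 0 w).1 ;
  embedded_init_indep : forall A B, state_measurable A -> sigma_counting N B ->
    P ((Z 0%N @^-1` A) `&` B) = (P (Z 0%N @^-1` A) * P B)%E ;
  embedded_flow : forall n w,
    (Z n.+1 w).1 = Phi (Z n w).2 (interarrival T n w) (Z n w).1 ;
  embedded_law : forall n i j B, sigma_past N Z n B ->
    P (B `&` [set w | (Z n w).2 = i] `&` [set w | (Z n.+1 w).2 = j]) =
    (\int[P]_(w in B `&` [set w | (Z n w).2 = i])
       (Q (Z n.+1 w).1 i j)%:E)%E }.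

Definition interpolates {R : realType} {d : nat} {E : finType} {Omega : Type}
    (Phi : E -> R -> 'rV[R]_d -> 'rV[R]_d) (T : nat -> Omega -> R)
    (Zt : nat -> Omega -> 'rV[R]_d * E) (Z : time R -> Omega -> 'rV[R]_d * E) :=
  forall (t : time R) n w, T n w <= \val t < T n.+1 w ->
    Z t w = (Phi (Zt n w).2 (\val t - T n w) (Zt n w).1, (Zt n w).2).

(* Main.v *)
(* [S^x] is closed: for a C-Lipschitz path, solving the inclusion on [0, b] is
   equivalent to having, for some L and all s <= t, weights a with
     |f t - f s - (t - s) sum_i a_i F^i(f s)| <= L (t - s)^2,
   and this passes to uniform limits. One direction covers the exceptional set by
   a small open set and uses absolute continuity; the other one needs that
   Lipschitz functions are differentiable almost everywhere (Radon-Nikodym). As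
   every path of the process solves the inclusion, the support lies in [S^x].

   Conversely, a solution f is followed with positive probability. Time is cut into
   periods of length about h, each made of #|E| very short interarrival times and a
   long one. At the beginning of a period, the position is localized in a small ball
   around some y, and the mode j minimizing <y - f, F^j(y)> is reached during the
   short steps by a path of modes whose rates are positive near y; following F^j
   during the long step multiplies the squared distance to f by at most 1 + O(h), up
   to an error O(h^2). A discrete Gronwall inequality bounds the squared distance
   by O(h) on bounded time intervals. *)

Require Import Defs.
From HB Require Import structures.
From mathcomp Require Import all_boot all_order all_algebra.
From mathcomp Require Import all_classical all_reals all_analysis.
From mathcomp Require Import measurable_realfun.
From mathcomp Require Import ring lra.

Set Implicit Arguments.
Unset Strict Implicit.
Unset Printing Implicit Defensive.

Import Order.TTheory GRing.Theory Num.Theory.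
Import numFieldNormedType.Exports.

Local Open Scope classical_set_scope.
Local Open Scope ring_scope.

(** * Flows of Lipschitz vector fields *)

(** The law of the next mode is prescribed only through integrals over events of the past, so the
    pursuit is run on events of positive probability rather than on trajectories. Whatever is chosen
    on the way (a ball, a path of modes, a field to follow) must then be constant on such an event.
    This is why the position is localized around a fixed y: the mode to reach and the path of modes
    leading to it are both read off at y. Since the conditioning contains the whole Poisson process,
    all jump times are constrained at the outset, and the modes are selected afterwards, one jump at
    a time. As the times are fixed before the modes are known, the number of short steps cannot
    depend on the path: keeping a mode has positive probability, so any two modes are joined by a
    path of exactly #|E| edges, loops included. The short steps and the timing errors take a time at
    most h^2 per period, so that they enter the squared distance through terms of order h^2, which
    add up to O(h). *)

Section row_vectors.
Context {R : realType} {d : nat}.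
Implicit Types v : 'rV[R]_d.

Lemma coord_norm_le v j : `|v 0 j| <= `|v|.
Proof.
rewrite [leRHS]/Num.norm /= mx_normrE; apply/bigmax_geP; right => /=.
by exists (0, j).
Qed.

Lemma norm_le_coord v r : 0 <= r -> (forall j, `|v 0 j| <= r) -> `|v| <= r.
Proof.
move=> r0 vr; rewrite [leLHS]/Num.norm /= mx_normrE; apply/bigmax_leP; split => //.
by move=> [i j] _ /=; rewrite ord1.
Qed.

Lemma is_derive_coord (f : R -> 'rV[R]_d) (t : R) v j :
  is_derive t 1 f v -> is_derive t 1 (fun s => f s 0 j) (v 0 j).
Proof.
move=> [df fv]; have /derivable_mxP dfj := df.
apply: DeriveDef; first exact: dfj.
by rewrite -fv derive_mx// mxE.
Qed.

(** The norm is the maximum of the coordinates, so the scalar mean value theorem can be applied to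
    each coordinate with its own intermediate point. *)
Lemma curve_increment (f g : R -> 'rV[R]_d) (w : 'rV[R]_d) (a b r : R) : a <= b ->
  (forall t, a <= t <= b -> is_derive t 1 f (g t)) ->
  (forall t, a <= t <= b -> `|g t - w| <= r) ->
  `|f b - f a - (b - a) *: w| <= r * (b - a).
Proof.
move=> ab fg gr.
have r0 : 0 <= r by rewrite (le_trans _ (gr a _)) ?lexx.
have ba0 : 0 <= b - a by rewrite subr_ge0.
apply: norm_le_coord => [|j]; first exact: mulr_ge0.
have fgj t : a <= t <= b -> is_derive t 1 (fun s => f s 0 j) (g t 0 j).
  by move=> atb; exact/is_derive_coord/fg.
have [||c cab e] := @MVT_segment R (fun s => f s 0 j) (fun s => g s 0 j) a b ab.
- by move=> t tab; apply: fgj; rewrite in_itv/= in tab; case/andP: tab => *; rewrite !ltW.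
- apply: derivable_within_continuous => t tab.
  by rewrite in_itv/= in tab; have [] := fgj t tab.
rewrite in_itv/= in cab.
rewrite !mxE e mulrC -mulrBr normrM (ger0_norm ba0) mulrC ler_wpM2r//.
by have := coord_norm_le (g c - w) j; rewrite !mxE => /le_trans; apply; exact: gr.
Qed.

End row_vectors.

Section lipschitz_on_balls.
Context {R : realType} {d : nat}.

Lemma closed_ball_compact (r : R) : compact [set x : 'rV[R]_d | `|x| <= r].
Proof.
apply: bounded_closed_compact.
  exists r; split; first by rewrite num_real.
  by move=> s rs x /= xr; exact: le_trans xr (ltW rs).
have -> : [set x : 'rV[R]_d | `|x| <= r] = Num.norm @^-1` [set s | s <= r] by [].
by apply: preimage_closed; [move=> x _; exact: norm_continuous|exact: closed_le].
Qed.

Lemma derive_row_decomp (F : 'rV[R]_d -> 'rV[R]_d) x v : differentiable F x ->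
  'D_v F x = \sum_k v 0 k *: 'D_(delta_mx 0 k) F x.
Proof.
move=> dF; rewrite deriveE// {1}(row_sum_delta v) linear_sum.
by apply: eq_bigr => k _; rewrite linearZ/= deriveE.
Qed.

Lemma is_derive_segment (F : 'rV[R]_d -> 'rV[R]_d) x v (s : R) :
  (forall y, differentiable F y) ->
  is_derive s 1 (fun t => F (x + t *: v)) ('D_v F (x + s *: v)).
Proof.
move=> dF.
have e : (fun h : R => h^-1 *: (F (x + (h *: 1 + s) *: v) - F (x + s *: v)))
    = (fun h : R => h^-1 *: (F (h *: v + (x + s *: v)) - F (x + s *: v))).
  apply/funext => h; congr (_ *: (F _ - _)).
  by rewrite scalerDl -[h *: 1]/(h * 1) mulr1 addrCA.
apply: DeriveDef; rewrite /derivable /derive/=.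
  by rewrite e; exact: diff_derivable.
by rewrite e.
Qed.

(** The partial derivatives are bounded on the compact ball, which is convex: the mean value
    inequality applies along the segment from y to x. The constant is the sum of the bounds. *)
Lemma C1_lipschitz_ball (F : 'rV[R]_d -> 'rV[R]_d) r :
  (forall x, differentiable F x) -> (forall v, continuous ('D_v F)) ->
  exists2 K, 0 <= K & forall x y, `|x| <= r -> `|y| <= r ->
    `|F x - F y| <= K * `|x - y|.
Proof.
move=> dF cF.
have : forall k : 'I_d, exists B, 0 <= B /\
    forall x, `|x| <= r -> `|'D_(delta_mx 0 k) F x| <= B.
  move=> k; set G := 'D_(delta_mx 0 k) F.
  have : compact (G @` [set x | `|x| <= r]).
    apply: continuous_compact; last exact: closed_ball_compact.
    by apply: continuous_subspaceT; exact: cF.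
  move=> /compact_bounded[B [_ BG]]; exists (`|B| + 1); split.
    by rewrite addr_ge0.
  by move=> x xr; apply: (BG (`|B| + 1)); [rewrite ltr_pwDr// ler_norm|exists x].
move=> /choice[B BP]; exists (\sum_k B k) => [|x y xr yr].
  by apply: sumr_ge0 => k _; case: (BP k).
pose v := x - y.
have := @curve_increment R d (fun t => F (y + t *: v))
  (fun t => 'D_v F (y + t *: v)) 0 0 1 ((\sum_k B k) * `|v|) ler01.
have -> : y + 1 *: v = x by rewrite scale1r /v addrC subrK.
rewrite scaler0 !subr0 mulr1 scale0r addr0; apply.
  by move=> t _; exact: is_derive_segment.
move=> t /andP[t0 t1].
have pr : `|y + t *: v| <= r.
  rewrite (_ : y + t *: v = (1 - t) *: y + t *: x); last first.
    by rewrite /v scalerBr scalerBl scale1r addrCA addrC.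
  rewrite (le_trans (ler_normD _ _))// !normrZ !ger0_norm// ?subr_ge0//.
  have := ler_wpM2l t0 xr; have : (1 - t) * `|y| <= (1 - t) * r.
    by rewrite ler_wpM2l// subr_ge0.
  lra.
rewrite subr0 derive_row_decomp// mulr_suml.
apply: (le_trans (ler_norm_sum _ _ _)); apply: ler_sum => k _.
rewrite normrZ mulrC ler_pM//; last exact: coord_norm_le.
by case: (BP k) => _; apply.
Qed.

End lipschitz_on_balls.

Section flow.
Context {R : realType} {d : nat} (F : 'rV[R]_d -> 'rV[R]_d) (C : R).
Hypothesis F_le : forall x, `|F x| <= C.
Context (phi : R -> 'rV[R]_d -> 'rV[R]_d).
Hypothesis phi_flow : is_flow F phi.

Lemma flow_lipschitz x (s t : R) : `|phi t x - phi s x| <= C * `|t - s|.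
Proof.
wlog st : s t / s <= t => [wl|].
  have [/wl//|/ltW/wl] := leP s t.
  by rewrite distrC (distrC s t).
have := @curve_increment R d (phi ^~ x) (fun t => F (phi t x)) 0 s t C st.
rewrite scaler0 subr0 ger0_norm ?subr_ge0//; apply.
  by move=> u _; case: phi_flow => _; apply.
by move=> u _; rewrite subr0.
Qed.

Lemma flow_near x (t : R) : 0 <= t -> `|phi t x - x| <= C * t.
Proof.
by move=> t0; have := flow_lipschitz x 0 t; rewrite (phi_flow.1 x) subr0 ger0_norm.
Qed.

Context (r K : R).
Hypothesis K_ge0 : 0 <= K.
Hypothesis F_lip : forall x y, `|x| <= r -> `|y| <= r ->
  `|F x - F y| <= K * `|x - y|.

Lemma flow_taylor x (s t : R) : s <= t ->
  (forall u, s <= u <= t -> `|phi u x| <= r) ->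
  `|phi t x - phi s x - (t - s) *: F (phi s x)| <= K * C * (t - s) ^+ 2.
Proof.
move=> st bd.
rewrite expr2 mulrA.
apply: (@curve_increment R d (phi ^~ x) (fun t => F (phi t x))) => // u sut.
  by case: phi_flow => _; apply.
have /andP[su ut] := sut.
have sr : `|phi s x| <= r by apply: bd; rewrite lexx.
apply: (le_trans (F_lip (bd _ sut) sr)).
rewrite -mulrA ler_wpM2l// (le_trans (flow_lipschitz _ _ _))//.
rewrite ger0_norm ?subr_ge0// ler_wpM2l ?lerD2r//.
exact: le_trans (F_le 0).
Qed.

End flow.

Section gronwall.
Context {R : realType}.

(** Each factor 1 + a is at most exp(a), and each added b is at most b times the exponential already
    accumulated. *)
Lemma discrete_gronwall (a b : R) (e : nat -> R) n : 0 <= a -> 0 <= b ->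
  0 <= e 0 -> (forall k, (k < n)%N -> e k.+1 <= (1 + a) * e k + b) ->
  e n <= expR (a * n%:R) * (e 0 + n%:R * b).
Proof.
move=> a0 b0 e0; elim: n => [|n ih] eS.
  by rewrite mulr0 expR0 mul1r mul0r addr0.
rewrite (le_trans (eS n _))//.
have {}ih := ih (fun k kn => eS k (leqW kn)).
have a1 : 1 + a <= expR a := expR_ge1Dx a.
have e1 : 1 <= expR (a * n.+1%:R) by rewrite -expR0 ler_expR mulr_ge0.
have nb : 0 <= e 0 + n%:R * b by rewrite addr_ge0// mulr_ge0.
have -> : e 0 + n.+1%:R * b = (e 0 + n%:R * b) + b.
  by rewrite -natr1 mulrDl mul1r addrA.
rewrite mulrDr lerD//; last by rewrite ler_peMl.
rewrite -natr1 (mulrDr a) mulr1 expRD (mulrC (expR _)) -mulrA.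
rewrite (le_trans (ler_wpM2l _ ih))//; first by rewrite addr_ge0.
by rewrite ler_wpM2r// mulr_ge0// expR_ge0.
Qed.

Lemma ler_add_invn (A B c : R) : 0 <= c ->
  (forall n, A <= B + c / n.+1%:R) -> A <= B.
Proof.
move=> c0 h; apply/ler_addgt0Pr => e e0.
pose n := Num.bound (c / e).
apply: le_trans (h n) _; rewrite lerD2l ler_pdivrMr// mulrC -ler_pdivrMr//.
rewrite (le_trans (ltW (archi_boundP _)))//; first by rewrite divr_ge0// ltW.
by rewrite ler_nat.
Qed.

End gronwall.

Section flow_continuity.
Context {R : realType} {d : nat} (F : 'rV[R]_d -> 'rV[R]_d) (C : R).
Hypothesis F_le : forall x, `|F x| <= C.
Context (phi : R -> 'rV[R]_d -> 'rV[R]_d).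
Hypothesis phi_flow : is_flow F phi.
Context (r K : R).
Hypothesis K_ge0 : 0 <= K.
Hypothesis F_lip : forall x y, `|x| <= r -> `|y| <= r ->
  `|F x - F y| <= K * `|x - y|.

(** Gronwall's inequality in discrete form: cut [0, t] into n + 1 steps of length h. By the Taylor
    estimate a step multiplies the distance by 1 + K h up to 2 K C h^2, and these errors add up to
    O(1 / (n + 1)), which vanishes in the limit. The bounds on |x| + C t and |y| + C t keep both
    orbits in the ball where F is K-Lipschitz. *)
Lemma flow_lipschitz_init (t : R) x y : 0 <= t ->
  `|x| + C * t <= r -> `|y| + C * t <= r ->
  `|phi t x - phi t y| <= expR (K * t) * `|x - y|.
Proof.
move=> t0 xr yr.
have C0 : 0 <= C := le_trans (normr_ge0 _) (F_le 0).
have bd z u : `|z| + C * t <= r -> 0 <= u <= t -> `|phi u z| <= r.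
  move=> zr /andP[u0 ut]; apply: le_trans zr.
  rewrite -[phi u z](subrK z) (le_trans (ler_normD _ _))// addrC lerD2l.
  by rewrite (le_trans (flow_near F_le phi_flow z u0))// ler_wpM2l.
apply: (@ler_add_invn _ _ _ (expR (K * t) * (2 * K * C * t ^+ 2))).
  by rewrite !mulr_ge0// ?expR_ge0// sqr_ge0.
move=> n; pose h := t / n.+1%:R.
have h0 : 0 <= h by rewrite divr_ge0.
have nh : n.+1%:R * h = t by rewrite /h mulrC divfK// pnatr_eq0.
pose e k := `|phi (k%:R * h) x - phi (k%:R * h) y|.
have := @discrete_gronwall R (K * h) (2 * K * C * h ^+ 2) e n.+1.
have -> : e n.+1 = `|phi t x - phi t y| by rewrite /e nh.
have -> : e 0 = `|x - y| by rewrite /e mul0r !phi_flow.1.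
rewrite -[K * h * _]mulrA [h * _]mulrC nh => g.
apply: le_trans (g _ _ _ _) _ => //.
- by rewrite mulr_ge0.
- by rewrite !mulr_ge0// sqr_ge0.
- move=> k kn; have kh : k.+1%:R * h = k%:R * h + h by rewrite -natr1 mulrDl mul1r.
  have kht : k.+1%:R * h <= t by rewrite -nh ler_wpM2r// ler_nat.
  have kh0 : 0 <= k%:R * h by rewrite mulr_ge0.
  have st : k%:R * h <= k.+1%:R * h by rewrite kh lerDl.
  have T z : `|z| + C * t <= r ->
    `|phi (k.+1%:R * h) z - phi (k%:R * h) z - h *: F (phi (k%:R * h) z)|
      <= K * C * h ^+ 2.
    move=> zr; have := @flow_taylor R d F C F_le phi phi_flow r K K_ge0 F_lip z _ _ st.
    rewrite (_ : k.+1%:R * h - k%:R * h = h); last by rewrite kh addrAC subrr add0r.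
    apply => u /andP[u1 u2].
    by apply: bd => //; rewrite (le_trans kh0 u1) (le_trans u2 kht).
  have Tx := T x xr; have Ty := T y yr.
  have bx : `|phi (k%:R * h) x| <= r.
    by apply: bd => //; rewrite kh0 (le_trans st kht).
  have b_y : `|phi (k%:R * h) y| <= r.
    by apply: bd => //; rewrite kh0 (le_trans st kht).
  have FF := ler_wpM2l h0 (F_lip bx b_y).
  rewrite /e.
  set a := phi (k.+1%:R * h) x in Tx *; set b := phi (k.+1%:R * h) y in Ty *.
  set a' := phi (k%:R * h) x in Tx FF *; set b' := phi (k%:R * h) y in Ty FF *.
  have -> : a - b = (a' - b') + (a - a' - h *: F a') - (b - b' - h *: F b')
      + h *: (F a' - F b').
    by rewrite scalerBr; apply/rowP => j; rewrite !mxE; ring.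
  have n1 := ler_normD ((a' - b') + (a - a' - h *: F a') - (b - b' - h *: F b'))
    (h *: (F a' - F b')).
  have n2 := ler_normB ((a' - b') + (a - a' - h *: F a')) (b - b' - h *: F b').
  have n3 := ler_normD (a' - b') (a - a' - h *: F a').
  rewrite normrZ (ger0_norm h0) in n1.
  lra.
- rewrite mulrDr lerD2l -[leRHS]mulrA ler_wpM2l ?expR_ge0// /h expr_div_n.
  have n0 : n.+1%:R != 0 :> R by rewrite pnatr_eq0.
  rewrite le_eqVlt; apply/orP; left; apply/eqP; field.
  by rewrite addrC natr1.
Qed.

End flow_continuity.

Lemma smooth_lipschitz_ball {R : realType} {d : nat}
    (F : 'rV[R]_d -> 'rV[R]_d) (r : R) : smooth F ->
  exists2 K, 0 <= K & forall x y, `|x| <= r -> `|y| <= r ->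
    `|F x - F y| <= K * `|x - y|.
Proof.
by move=> /(_ 1%N)[dF cF]; exact: C1_lipschitz_ball.
Qed.

Lemma bounded_fun_norm_le {R : realType} {d : nat} (F : 'rV[R]_d -> 'rV[R]_d) :
  bounded_fun F -> exists2 C, 0 <= C & forall x, `|F x| <= C.
Proof.
move=> [B [_ FB]]; exists (`|B| + 1); first by rewrite addr_ge0.
move=> x; apply: (FB (`|B| + 1)) => //=.
by rewrite ltr_pwDr// ler_norm.
Qed.

Lemma flow_continuous {R : realType} {d : nat} (F : 'rV[R]_d -> 'rV[R]_d)
    (phi : R -> 'rV[R]_d -> 'rV[R]_d) (t : R) :
  smooth F -> bounded_fun F -> is_flow F phi -> 0 <= t -> continuous (phi t).
Proof.
move=> sF /bounded_fun_norm_le[C C0 FC] pF t0 /= x.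
(* The radius accommodates the orbits up to time t of all y at distance less than 1 from x. *)
have [K K0 FK] := smooth_lipschitz_ball (`|x| + 1 + C * t) sF.
apply/(@cvgrPdist_lt _ _ _ (nbhs (x : 'rV[R]_d)) _) => e e0.
have E0 := expR_gt0 (K * t).
near=> y.
have xy : `|x - y| < 1 by near: y; apply: cvgr_dist_lt.
have yx : `|y| <= `|x| + 1.
  by have := lerB_dist y x; rewrite distrC; lra.
rewrite (le_lt_trans (flow_lipschitz_init FC pF K0 FK t0 _ _))//.
- by rewrite lerD2r lerDl.
- by rewrite lerD2r.
rewrite mulrC -ltr_pdivlMr//.
by near: y; apply: cvgr_dist_lt; rewrite // divr_gt0.
Unshelve. all: by end_near. Qed.

(** * Lipschitz and absolutely continuous functions *)

Section half_lipschitz.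
Context {R : realType} (f : R -> R).
Hypothesis f_lip : forall x y, `|f x - f y| <= `|x - y| / 2.
Let mu := @lebesgue_measure R.

(** Adding x / 2 to a 1/2-Lipschitz function makes it nondecreasing, hence the distribution function
    of a Stieltjes measure. *)
Definition tilt (x : R) : R := x / 2 + f x.

Lemma tilt_nondecreasing : nondecreasing tilt.
Proof.
move=> x y xy; have := f_lip x y; rewrite distrC (distrC x) ler_norml.
by rewrite (ger0_norm (_ : 0 <= y - x)) ?subr_ge0// /tilt => /andP[]; lra.
Qed.

Lemma tilt_continuous : continuous tilt.
Proof.
move=> x; apply/(@cvgrPdist_le _ R^o) => e e0; near=> y.
have xy : `|x - y| <= e by near: y; apply: cvgr_dist_le.
have := f_lip x y; rewrite /tilt => h.
have -> : x / 2 + f x - (y / 2 + f y) = (x - y) / 2 + (f x - f y) by lra.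
rewrite (le_trans (ler_normD _ _))// normrM (ger0_norm (_ : 0 <= 2^-1)) ?invr_ge0//.
lra.
Unshelve. all: by end_near. Qed.

Definition tilt_cumulative : cumulative R R :=
  HB.pack tilt (isCumulative.Build R _ R tilt tilt_nondecreasing
    (right_continuousW tilt_continuous)).

Definition tilt_measure : set (measurableTypeR R) -> \bar R :=
  lebesgue_stieltjes_measure tilt_cumulative.

HB.instance Definition _ := Measure.on tilt_measure.

Lemma tilt_measure_itv a b : a <= b ->
  tilt_measure `]a, b]%classic = (tilt b - tilt a)%:E.
Proof.
move=> ab; rewrite /tilt_measure /lebesgue_stieltjes_measure/= /measure_extension.
by rewrite measurable_mu_extE//= ?wlength_itv_bnd//; exact: is_ocitv.
Qed.

End half_lipschitz.

Section half_lipschitz_derivable.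
Context {R : realType} (f : R -> R).
Hypothesis f_lip : forall x y, `|f x - f y| <= `|x - y| / 2.
Let fN_lip : forall x y, `|- f x - - f y| <= `|x - y| / 2.
Proof. by move=> x y; rewrite -opprD normrN. Qed.
Local Notation mu := (@lebesgue_measure R).
Local Notation nu := (tilt_measure f_lip).
Local Notation nuN := (tilt_measure fN_lip).

(* The Stieltjes measures of [x / 2 + f x] and [x / 2 - f x] add up to the
   Lebesgue measure, so that both are absolutely continuous. *)
Lemma tilt_measure_le A : measurable A -> (nu A <= mu A)%E.
Proof.
move=> mA; have -> : mu A = measure_add nu nuN A.
  apply: lebesgue_measure_unique => // X /ocitvP[->|[[a b]/= ab ->]].
    by rewrite !measure0.
  rewrite -[RHS]/(measure_add nu nuN `]a, b]%classic) measure_addE.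
  rewrite [X in (X + _)%E](tilt_measure_itv f_lip (ltW ab)).
  rewrite [X in (_ + X)%E](tilt_measure_itv fN_lip (ltW ab)).
  rewrite lebesgue_measure_itv/= lte_fin ab -EFinB -EFinD /tilt.
  by congr (_%:E); lra.
by rewrite measure_addE leeDl// measure_ge0.
Qed.

(** Restricted to ]-n, n], the Stieltjes measure of [tilt] is finite and dominated by the Lebesgue
    measure. Its Radon-Nikodym density g has [tilt] as a primitive up to a constant, and the
    integral of g is differentiable almost everywhere by the fundamental theorem of calculus. *)
Lemma half_lipschitz_ae_derivable_itv (n : R) : 0 < n ->
  {ae mu, forall x, - n < x < n -> derivable f x 1}.
Proof.
move=> n0; pose D : set (measurableTypeR R) := `]- n, n]%classic.
have mD : measurable D by exact: measurable_itv.
have nn : - n <= n by lra.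
have Doo : (nu D < +oo)%E.
  by rewrite /D tilt_measure_itv// ltry.
pose nuD : {finite_measure set (measurableTypeR R) -> \bar R} :=
  @mfrestr _ (measurableTypeR R) R D nu mD Doo.
have dom : nuD `<< mu.
  apply/null_content_dominatesP => A mA A0; apply/eqP; rewrite eq_le measure_ge0 andbT.
  rewrite /nuD /mfrestr /mrestr -A0 (le_trans (tilt_measure_le _))//.
    exact: measurableI.
  by rewrite le_measure ?inE//; exact: measurableI.
pose g := Radon_Nikodym_SigmaFinite.f nuD mu.
have g_int := Radon_Nikodym_SigmaFinite.f_integrable dom.
have g_fin := Radon_Nikodym_SigmaFinite.f_fin_num dom.
have gE : EFin \o (fine \o g) = g by apply/funext => x /=; rewrite fineK.
have g_int' (y : R) : mu.-integrable [set` Interval (BRight (- n)) (BRight y)] g.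
  by apply: (integrableS measurableT) => //; exact: measurable_itv.
have := @FTC1 R (fine \o g) (BRight (- n)).
rewrite gE => ftc.
have : locally_integrable setT (fine \o g).
  have := @integrable_locally R (fine \o g) setT measurableT.
  by rewrite patch_setT gE; apply.
move=> /(ftc g_int').
apply: filterS; first exact: (ae_filter_ringOfSetsType lebesgue_measure).
move=> x h /andP[nx xn].
have [+ _] := h nx.
set F := (F in derivable F x 1) => dF.
have FE y : - n < y < n -> F y = tilt f y - tilt f (- n).
  move=> /andP[ny yn]; rewrite /F /Rintegral/=.
  pose I : set (measurableTypeR R) := `]- n, y]%classic.
  have -> : (\int[mu]_(t in I) (fine (g t))%:E)%E = nuD I.
    rewrite (Radon_Nikodym_SigmaFinite.f_integral dom)//; last exact: measurable_itv.
    by apply: eq_integral => t _; rewrite fineK.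
  have -> : nuD I = nu I.
    rewrite -[LHS]/(nu (I `&` D)) setIidl//.
    by apply: subset_itvl; rewrite bnd_simp ltW.
  by rewrite [X in fine X](tilt_measure_itv f_lip (ltW ny)).
have nearx : \forall y \near x, - n < y < n.
  near=> y; apply/andP; split; near: y; [exact: lt_nbhsr|exact: lt_nbhsl].
have : derivable (fun y => tilt f y - tilt f (- n)) x 1.
  apply: near_eq_derivable dF.
  by apply: filterS nearx => y /FE ->.
move=> dG.
have -> : f = (fun y => tilt f y - tilt f (- n)) + cst (tilt f (- n)) - (fun y => 2^-1 * y).
  by apply/funext => y; rewrite /tilt !fctE; lra.
have dH : derivable (fun y : R => 2^-1 * y) x 1.
  by apply: derivableM; [exact: derivable_cst|exact: derivable_id].
exact: (derivableB (derivableD dG (derivable_cst (tilt f (- n)) x 1)) dH).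
Unshelve. all: by end_near. Qed.

End half_lipschitz_derivable.

Lemma lipschitz_ae_derivable {R : realType} (f : R -> R) (C : R) :
  (forall x y, `|f x - f y| <= C * `|x - y|) ->
  {ae lebesgue_measure, forall x, derivable f x 1}.
Proof.
(* Scaling by c brings the Lipschitz constant to at most 1/2; |C| + 1 is positive whatever C is. *)
move=> fC; pose c := (2 * (`|C| + 1))^-1.
have c0 : 0 < c by rewrite invr_gt0 mulr_gt0// ltr_pwDr.
have cf x y : `|c * f x - c * f y| <= `|x - y| / 2.
  rewrite -mulrBr normrM (gtr0_norm c0) (le_trans (ler_wpM2l (ltW c0) (fC x y)))//.
  rewrite mulrA mulrC ler_wpM2l// /c invfM -mulrA ger_pMr ?invr_gt0//.
  rewrite mulrC ler_pdivrMr ?ltr_pwDr// mul1r.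
  by rewrite (le_trans (ler_norm _))// lerDl.
have : {ae lebesgue_measure, forall x, forall n : nat, - n.+1%:R < x < n.+1%:R ->
    derivable (fun y => c * f y) x 1}.
  by apply: ae_foralln => n; exact: half_lipschitz_ae_derivable_itv.
apply: filterS; first exact: (ae_filter_ringOfSetsType lebesgue_measure).
move=> x h; have -> : f = (fun y => c^-1 * (c * f y)).
  by apply/funext => y; rewrite mulKf// gt_eqF.
apply: derivableM; first exact: derivable_cst.
apply: (h (Num.bound `|x|)).
rewrite -ltr_norml (lt_trans (archi_boundP _))// ltr_nat//.
Qed.

(** Induction on the real line: at the supremum c of the z such that P holds from a to z, the local
    hypothesis carries P past c, unless c is b. It replaces a compactness argument with
    subdivisions. *)
Lemma additive_local_itv {R : realType} (P : R -> R -> Prop) (a b : R) :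
  a <= b ->
  (forall u v w, a <= u -> u <= v -> v <= w -> w <= b ->
     P u v -> P v w -> P u w) ->
  (forall x, a <= x <= b -> exists2 del : R, 0 < del &
     forall u v, a <= u -> u <= x -> x <= v -> v <= b ->
       x - u < del -> v - x < del -> P u v) ->
  P a b.
Proof.
move=> ab Padd Ploc.
pose A := [set z | a <= z <= b /\ P a z].
have Aa : A a.
  split; first by rewrite lexx.
  have [|del del0 h] := Ploc a; first by rewrite lexx.
  by apply: h; rewrite ?lexx ?subrr.
have Ab : ubound A b by move=> z [/andP[]].
have supA : has_sup A by split; [exists a|exists b].
pose c := sup A.
have ac : a <= c by apply: ub_le_sup => //; exists b.
have cb : c <= b by apply: ge_sup => //; exists a.
have [|del del0 h] := Ploc c; first by rewrite ac cb.
have [z [/andP[az zb] Pz] zc] := sup_adherent del0 supA.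
have zc' : z <= c by apply: ub_le_sup => //; [exists b|split => //; rewrite az zb].
(* v lies to the right of c unless it is cut off at b; since v is again in A, it cannot exceed c, so
   that v = b. *)
pose v := Num.min b (c + del / 2).
have cv : c <= v by rewrite /v le_min cb/= lerDl divr_ge0// ltW.
have vb : v <= b by rewrite /v ge_min lexx.
have vc : v <= c + del / 2 by rewrite /v ge_min lexx orbT.
have Av : A v.
  split; first by rewrite vb (le_trans ac cv).
  apply: (Padd a z v) => //; first exact: le_trans cv.
  by apply: h => //; rewrite -/c in zc *; lra.
have vc' : v <= c by apply: ub_le_sup => //; exists b.
have vE : v = b.
  rewrite /v; case: (leP b (c + del / 2)) => //= cdb.
  have vE : v = c + del / 2 by rewrite /v min_r// ltW.
  by have := vc'; rewrite vE => cc; lra.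
by case: Av => _; rewrite vE.
Qed.

(** * Mean value theorem for absolutely continuous curves with derivatives in a convex set *)

Section absolutely_continuous_increments.
Context {R : realType} {d : nat}.
Local Notation mu := (@lebesgue_measure R).

Lemma is_derive_approx (f : R -> 'rV[R]_d) (x : R) v (e : R) : is_derive x 1 f v ->
  0 < e -> exists2 del : R, 0 < del &
    forall y, `|y - x| < del -> `|f y - f x - (y - x) *: v| <= e * `|y - x|.
Proof.
move=> [df <-] e0.
have /(@cvgrPdist_le _ _ _ (0^')%classic) /(_ e e0) := df.
move=> /nbhs_ballP[del /= del0 h]; exists del => // y yx.
have [->|yx0] := eqVneq y x; first by rewrite !subrr scale0r subr0 !normr0 mulr0.
have yx1 : y - x != 0 by rewrite subr_eq0.
have := h (y - x).
rewrite /ball/= sub0r normrN => /(_ yx yx1).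
rewrite -[(y - x) *: 1]/((y - x) * 1) mulr1 subrK => hy.
have -> : f y - f x - (y - x) *: 'D_1 f x =
    - (y - x) *: ('D_1 f x - (y - x)^-1 *: (f y - f x)).
  rewrite scalerBr scalerA mulNr divff// scaleN1r opprK scaleNr.
  by rewrite addrC.
by rewrite normrZ normrN mulrC ler_wpM2r.
Qed.

Lemma abs_continuousS (f : R -> 'rV[R]_d) a b a' b' : a <= a' -> b' <= b ->
  abs_continuous a b f -> abs_continuous a' b' f.
Proof.
move=> aa bb acf e e0; have [del del0 h] := acf e e0.
exists del => // n l r lr; apply: h => i; have [al lri rb] := lr i.
by split => //; [exact: le_trans al|exact: le_trans bb].
Qed.

Lemma sum_itv_length_le n (l r : 'I_n -> R) (U : set R) :
  measurable U ->
  (forall i, l i <= r i) -> trivIset setT (fun i => `]l i, r i[%classic) ->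
  (forall i, `]l i, r i[%classic `<=` U) ->
  ((\sum_i (r i - l i))%:E <= mu U)%E.
Proof.
move=> mU lr tlr lrU.
rewrite -sumEFin.
have -> : (\sum_i (r i - l i)%:E = \sum_i mu `]l i, r i[%classic)%E.
  apply: eq_bigr => i _; rewrite lebesgue_measure_itv/= lte_fin.
  case: ltP => [_|rl]; first by rewrite EFinB.
  by have /eqP -> : r i == l i; [rewrite eq_le rl lr|rewrite subrr].
rewrite -measure_bigsetU_ord//.
apply: le_measure; rewrite ?inE//; first exact: bigsetU_measurable.
by elim/big_ind: _ => // A B AU BU; rewrite subUset.
Qed.

(** The mean of the derivative belongs to K up to any e, without integrating vector functions. The
    estimate is local, from the definition of the derivative, and additive over adjacent intervals,
    as K is convex. The error e is kept because K need not be closed. *)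
Lemma abs_continuous_increment (f : R -> 'rV[R]_d) (a b : R)
    (K : set 'rV[R]_d) k0 (e : R) :
  abs_continuous a b f -> a <= b ->
  (forall k l t, K k -> K l -> 0 <= t <= 1 -> K (t *: k + (1 - t) *: l)) ->
  K k0 ->
  {ae mu, forall t, a <= t <= b -> exists2 v, K v & is_derive t 1 f v} ->
  0 < e ->
  exists2 k, K k & `|f b - f a - (b - a) *: k| <= e.
Proof.
move=> acf ab Kconv Kk0 [N [mN N0 NP]] e0.
have e40 : 0 < e / 4 by rewrite divr_gt0.
have [del1 del10 acf1] := acf _ e40.
(* Budget for e: e/2 for the expansions at points of differentiability, through [eta]; e/4 for the
   increments of f over the intervals in [U], and e/4 for |k0| times their total length, through the
   two bounds in [del]. *)
pose del := Num.min del1 (e / 4 / (`|k0| + 1)).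
have k01 : 0 < `|k0| + 1 by rewrite ltr_pwDr.
have del0 : 0 < del by rewrite /del lt_min del10/= divr_gt0.
pose eta := e / 2 / (b - a + 1).
have ba1 : 0 < b - a + 1 by rewrite ltr_pwDr// subr_ge0.
have eta0 : 0 < eta by rewrite !divr_gt0.
have Noo : (mu N < +oo)%E by rewrite N0 ltry.
have [U [oU NU UN]] := lebesgue_regularity_outer mN Noo del0.
have mU : measurable U by exact: measurable_realfun.open_measurable.
have Udel : (mu U < del%:E)%E.
  rewrite -(setDKU NU) (le_lt_trans (measureU2 _ _ _))//; first exact: measurableD.
  by rewrite [X in (_ + X)%E]N0 adde0.
(* The intervals collected in [U], where the derivative may fail to exist, have small
   total length, so that [err] is controlled by absolute continuity. *)
pose err n (l r : 'I_n -> R) := \sum_i (`|f (r i) - f (l i)| + `|k0| * (r i - l i)).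
pose P u v := exists k n (l r : 'I_n -> R), [/\ K k,
  forall i, [/\ u <= l i, l i <= r i & r i <= v],
  forall i, `]l i, r i[%classic `<=` U,
  trivIset setT (fun i => `]l i, r i[%classic) &
  `|f v - f u - (v - u) *: k| <= eta * (v - u) + err n l r].
have : P a b.
  apply: additive_local_itv => //.
  - move=> u v w au uv vw wb [k1 [n1 [l1 [r1 [Kk1 lr1 U1 T1 h1]]]]]
      [k2 [n2 [l2 [r2 [Kk2 lr2 U2 T2 h2]]]]].
    (* The vector for [u, w] is the mean of k1 and k2 weighted by the lengths; here the convexity of
       K enters. *)
    have [k Kk kE] : exists2 k, K k & (w - u) *: k = (v - u) *: k1 + (w - v) *: k2.
      have [wu|wu] := eqVneq w u.
        exists k1 => //; have vu : v = u by apply/eqP; rewrite eq_le uv -wu vw.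
        by rewrite wu vu !subrr !scale0r addr0.
      have wu0 : 0 < w - u by rewrite subr_gt0 lt_neqAle eq_sym wu (le_trans uv vw).
      exists (((v - u) / (w - u)) *: k1 + (1 - (v - u) / (w - u)) *: k2).
        apply: Kconv => //; rewrite divr_ge0 ?subr_ge0// ?(le_trans uv vw)//=.
        by rewrite ler_pdivrMr// mul1r lerB.
      rewrite scalerDr !scalerA; congr (_ *: _ + _ *: _); field; rewrite gt_eqF//.
    pose l i := match fintype.split i with inl j => l1 j | inr j => l2 j end.
    pose r i := match fintype.split i with inl j => r1 j | inr j => r2 j end.
    exists k, (n1 + n2)%N, l, r; split => //.
    + move=> i; rewrite /l /r; case: (fintype.split i) => j.
        by have [? ? rv] := lr1 j; split => //; exact: le_trans vw.
      by have [vl ? ?] := lr2 j; split => //; exact: le_trans vl.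
    + by move=> i; rewrite /l /r; case: (fintype.split i) => j.
    + move=> i j _ _; rewrite /l /r.
      have cross (j1 : 'I_n1) (j2 : 'I_n2) :
          `]l1 j1, r1 j1[%classic `&` `]l2 j2, r2 j2[%classic !=set0 -> False.
        move=> [z [/=]]; rewrite !in_itv/= => /andP[_ z1] /andP[z2 _].
        by have [_ _ rv] := lr1 j1; have [vl _ _] := lr2 j2; lra.
      rewrite -[in RHS](fintype.splitK j) -[in LHS](fintype.splitK i).
      case: (fintype.split i) => i'; case: (fintype.split j) => j' /= h.
      * by congr lshift; exact: T1.
      * by case: (cross _ _ h).
      * by rewrite setIC in h; case: (cross _ _ h).
      * by congr rshift; exact: T2.
    + have -> : err _ l r = err _ l1 r1 + err _ l2 r2.
        rewrite /err big_split_ord/=; congr (_ + _); apply: eq_bigr => i _.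
          by rewrite /l /r (fintype.unsplitK (inl i)).
        by rewrite /l /r (fintype.unsplitK (inr i)).
      rewrite kE.
      have -> : f w - f u - ((v - u) *: k1 + (w - v) *: k2) =
        (f v - f u - (v - u) *: k1) + (f w - f v - (w - v) *: k2).
        by rewrite opprD addrACA addrC -[in RHS]addrA; apply/rowP => i; rewrite !mxE; ring.
      by rewrite (le_trans (ler_normD _ _))//; lra.
  (* At a point of [N], the whole interval ]u, v[ is charged to [U], with the default vector k0. At
     any other point the derivative serves as k and no interval is charged. *)
  - move=> x axb; have [xN|xN] := pselect (N x).
      have Ux : nbhs x U by apply: open_nbhs_nbhs; split => //; exact: NU.
      have /nbhs_ballP[eps /= eps0 xU] := Ux.
      exists eps => // u v au ux xv vb xu vx.
      exists k0, 1%N, (fun=> u), (fun=> v); split => //.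
      + by move=> _; rewrite !lexx (le_trans ux xv).
      + move=> _ z /=; rewrite in_itv/= => /andP[uz zv]; apply: xU.
        by rewrite /ball/= ltr_norml; apply/andP; split; lra.
      + by move=> i j _ _ _; rewrite !ord1.
      + rewrite /err big_ord1 (le_trans (ler_normB _ _))// normrZ ger0_norm; last first.
          by rewrite subr_ge0 (le_trans ux xv).
        rewrite (mulrC `|k0|) lerDr mulr_ge0 ?subr_ge0//; first exact: ltW.
        exact: le_trans xv.
    have [v0 Kv0 dv0] : exists2 v, K v & is_derive x 1 f v.
      by apply: contrapT => h; apply: xN; apply: NP => /= /(_ axb).
    have [eps eps0 h] := is_derive_approx dv0 eta0.
    exists eps => // u v au ux xv vb xu vx.
    exists v0, 0%N, (fun=> 0), (fun=> 0); split => //; try by case.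
    rewrite /err big_ord0 addr0.
    have hu := h u; have hv := h v.
    rewrite ler0_norm ?subr_le0// opprB in hu.
    rewrite ger0_norm ?subr_ge0// in hv.
    have -> : f v - f u - (v - u) *: v0 =
      (f v - f x - (v - x) *: v0) - (f u - f x - (u - x) *: v0).
      by apply/rowP => i; rewrite !mxE; ring.
    rewrite (le_trans (ler_normB _ _))//.
    have := hu xu; have := hv vx; lra.
move=> [k [n [l [r [Kk lr lrU tlr h]]]]]; exists k => //.
have lr' i : l i <= r i by case: (lr i).
have slr : \sum_i (r i - l i) < del.
  by rewrite -lte_fin (le_lt_trans _ Udel)//; exact: sum_itv_length_le.
have s1 : \sum_i `|f (r i) - f (l i)| < e / 4.
  by apply: acf1 => //; rewrite (lt_le_trans slr)// /del ge_min lexx.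
have s2 : \sum_i `|k0| * (r i - l i) <= e / 4.
  rewrite -mulr_sumr (le_trans (ler_wpM2l _ (ltW slr)))//.
  have : del <= e / 4 / (`|k0| + 1) by rewrite /del ge_min lexx orbT.
  rewrite ler_pdivlMr// mulrC => /(le_trans _); apply.
  by rewrite ler_wpM2r ?lerDl// ltW.
have s3 : eta * (b - a) <= e / 2.
  by rewrite /eta -mulrA ger_pMr ?divr_gt0// mulrC ler_pdivrMr// mul1r lerDl.
apply: (le_trans h); rewrite /err big_split/=; lra.
Qed.

End absolutely_continuous_increments.

(** * The differential inclusion *)

Definition weights {R : realType} {E : finType} (a : E -> R) :=
  (forall i, 0 <= a i) /\ \sum_i a i = 1.

Definition is_solution {R : realType} {d : nat} {E : finType}
    (F : E -> 'rV[R]_d -> 'rV[R]_d) (f : R -> 'rV[R]_d) :=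
  (forall b, 0 <= b -> abs_continuous 0 b f) /\
  {ae lebesgue_measure, forall t : R, 0 <= t ->
     exists2 v, convexified F (f t) v & is_derive t 1 f v}.

(* A first-order expansion along a frozen convex combination of the fields:
   unlike the differential inclusion it passes to uniform limits. *)
Definition frozen_expansion {R : realType} {d : nat} {E : finType}
    (F : E -> 'rV[R]_d -> 'rV[R]_d) (b L : R) (f : R -> 'rV[R]_d) :=
  forall s t, 0 <= s -> s <= t -> t <= b -> exists2 a : E -> R, weights a &
    `|f t - f s - (t - s) *: \sum_i a i *: F i (f s)| <= L * (t - s) ^+ 2.

Lemma continuous_finsum {R : realType} {T : topologicalType}
    {V : normedModType R} {I : finType} (f : I -> T -> V) :
  (forall i, continuous (f i)) -> continuous (fun x => \sum_i f i x).
Proof.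
by move=> cf; apply: continuous_big => //; exact: pseudometric_normed_Zmodule.add_continuous.
Qed.

Lemma sum_enum_val {V : nmodType} {E : finType} (G : E -> V) :
  \sum_(k < #|E|) G (enum_val k) = \sum_i G i.
Proof.
rewrite [RHS](reindex (fun k : 'I_#|E| => enum_val k))//=.
by apply: onW_bij; exact: enum_val_bij.
Qed.

Section convex_combinations.
Context {R : realType} {d : nat} {E : finType}.
Context (F : E -> 'rV[R]_d -> 'rV[R]_d).

Lemma convexifiedP x v :
  convexified F x v <-> exists2 a, weights a & v = \sum_i a i *: F i x.
Proof. by split=> [[a [a0 a1 ->]]|[a [a0 a1] ->]]; exists a. Qed.

Lemma weights_conv (a b : E -> R) (t : R) : weights a -> weights b ->
  0 <= t <= 1 -> weights (fun i => t * a i + (1 - t) * b i).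
Proof.
move=> [a0 a1] [b0 b1] /andP[t0 t1]; split.
  by move=> i; rewrite addr_ge0// mulr_ge0// subr_ge0.
by rewrite big_split/= -!mulr_sumr a1 b1 !mulr1 addrC subrK.
Qed.

Lemma norm_weighted_le (a : E -> R) (v : E -> 'rV[R]_d) (c : R) : weights a ->
  (forall i, `|v i| <= c) -> `|\sum_i a i *: v i| <= c.
Proof.
move=> [a0 a1] vc; rewrite (le_trans (ler_norm_sum _ _ _))//.
rewrite -[leRHS]mul1r -a1 mulr_suml; apply: ler_sum => i _.
by rewrite normrZ (ger0_norm (a0 i)) ler_wpM2l.
Qed.

Lemma weighted_dist_le (a : E -> R) x y (c : R) : weights a ->
  (forall i, `|F i x - F i y| <= c) ->
  `|\sum_i a i *: F i x - \sum_i a i *: F i y| <= c.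
Proof.
move=> wa h; rewrite -sumrB; under eq_bigr do rewrite -scalerBr.
exact: norm_weighted_le.
Qed.

(** The weights form a compact simplex, so co(F)(x) is its image under a continuous map, hence
    closed. Weights are turned into row vectors through the enumeration of E, for which products of
    segments are known to be compact. *)
Lemma convexified_closed x v :
  (forall e : R, 0 < e ->
     exists2 a, weights a & `|v - \sum_i a i *: F i x| <= e) ->
  convexified F x v.
Proof.
move=> h; pose g (a : 'rV[R]_#|E|) : 'rV[R]_d := \sum_k a 0 k *: F (enum_val k) x.
pose S := [set a : 'rV[R]_#|E| | forall k, `[0, 1]%classic (a ord0 k)] `&`
          [set a | \sum_k a 0 k = 1].
have cS : compact S.
  apply: compact_closedI.
    apply: (@rV_compact _ _ (fun=> `[(0 : R), (1 : R)]%classic)) => _.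
    exact: segment_compact.
  apply: (@preimage_closed _ _ (fun a : 'rV[R]_#|E| => \sum_k a 0 k) [set 1]);
    last exact: closed_eq.
  move=> a _; apply: continuous_finsum => k; exact: coord_continuous.
have cg : continuous g.
  apply: continuous_finsum => k a.
  apply: (@cvgZr_tmp R 'rV[R]_d _ (nbhs a) _ (fun z : 'rV[R]_#|E| => z 0 k)).
  exact: coord_continuous.
have cgS : closed (g @` S).
  apply: compact_closed; first exact: norm_hausdorff.
  by apply: continuous_compact cS; exact: continuous_subspaceT.
have [a [a01 a1] <-] : (g @` S) v.
  apply: cgS => B /nbhs_ballP[e /= e0 vB].
  have e20 : 0 < e / 2 by rewrite divr_gt0.
  have [a [a0 a1] av] := h _ e20.
  exists (\sum_i a i *: F i x); split; last first.
    by apply: vB; rewrite -ball_normE /ball_/= (le_lt_trans av)//; lra.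
  exists (\row_k a (enum_val k)).
    split => /= [k|].
      rewrite mxE in_itv/= a0/= -a1 (bigD1 (enum_val k))//= lerDl.
      by apply: sumr_ge0.
    under eq_bigr do rewrite mxE.
    by rewrite sum_enum_val.
  rewrite /g; under eq_bigr do rewrite mxE.
  by rewrite (sum_enum_val (fun i => a i *: F i x)).
exists (fun i => a 0 (enum_rank i)); split.
- by move=> i; have := a01 (enum_rank i); rewrite /= in_itv/= => /andP[].
- by rewrite -a1 -sum_enum_val; apply: eq_bigr => k _; rewrite enum_valK.
- by rewrite -[RHS]sum_enum_val; apply: eq_bigr => k _; rewrite enum_valK.
Qed.

End convex_combinations.

Section solutions.
Context {R : realType} {d : nat} {E : finType}.
Context (F : E -> 'rV[R]_d -> 'rV[R]_d) (C : R).
Hypothesis C_ge0 : 0 <= C.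
Hypothesis F_le : forall i x, `|F i x| <= C.
Local Notation mu := (@lebesgue_measure R).

(** The closed ball of radius C is convex and contains all values of co(F), so it can play the role
    of K in [abs_continuous_increment]. *)
Lemma solution_lipschitz (f : R -> 'rV[R]_d) (s t : R) : is_solution F f ->
  0 <= s -> s <= t -> `|f t - f s| <= C * (t - s).
Proof.
move=> [acf aef] s0 st; apply/ler_addgt0Pr => e e0.
pose K := [set v : 'rV[R]_d | `|v| <= C].
have acst := abs_continuousS s0 (lexx t) (acf t (le_trans s0 st)).
have [|||k Kk h] := @abs_continuous_increment R d f s t K 0 e acst st _ _ _ e0.
- move=> k l u kC lC /andP[u0 u1]; rewrite /K/= (le_trans (ler_normD _ _))//.
  rewrite !normrZ !ger0_norm ?subr_ge0//.
  have h1 := ler_wpM2l u0 kC; have h2 : (1 - u) * `|l| <= (1 - u) * C.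
    by rewrite ler_wpM2l// subr_ge0.
  by lra.
- by rewrite /K/= normr0.
- apply: filterS aef; first exact: (ae_filter_ringOfSetsType mu).
  move=> u h /andP[su _]; have [|v cv dv] := h.
    exact: le_trans su.
  exists v => //; have /convexifiedP[a wa ->] := cv.
  exact: norm_weighted_le.
- rewrite -[f t - f s](subrK ((t - s) *: k)) (le_trans (ler_normD _ _))//.
  rewrite addrC lerD// normrZ ger0_norm ?subr_ge0// mulrC.
  by rewrite ler_wpM2r// subr_ge0.
Qed.

Lemma weights1 (i0 : E) : weights (fun i => (i == i0)%:R : R).
Proof.
split=> [i|]; first by rewrite ler0n.
by rewrite (bigD1 i0)//= eqxx big1 ?addr0// => i /negbTE ->.
Qed.

(** On [s, t] the curve moves by at most C (t - s), so its derivative stays within K C (t - s) of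
    co(F)(f s). This neighbourhood is convex and [abs_continuous_increment] applies to it; the extra
    1 in the constant is its tolerance, taken equal to (t - s)^2. *)
Lemma solution_frozen_expansion (i0 : E) (f : R -> 'rV[R]_d) (b r K : R) :
  is_solution F f -> 0 <= K -> `|f 0| + C * b <= r ->
  (forall i x y, `|x| <= r -> `|y| <= r -> `|F i x - F i y| <= K * `|x - y|) ->
  frozen_expansion F b (K * C + 1) f.
Proof.
move=> sf K0 fr FK s t s0 st tb.
have bd u : 0 <= u -> u <= b -> `|f u| <= r.
  move=> u0 ub; have := solution_lipschitz sf (lexx 0) u0; rewrite subr0 => h.
  rewrite -[f u](subrK (f 0)) (le_trans (ler_normD _ _))//.
  apply: le_trans fr; rewrite addrC lerD2l (le_trans h)//.
  by rewrite ler_wpM2l.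
have [acf aef] := sf.
(* The tolerance (t - s)^2 has to be positive, so t = s is treated apart, with arbitrary weights. *)
have [ts|] := eqVneq t s.
  exists (fun i => (i == i0)%:R); first exact: weights1.
  by rewrite ts !subrr scale0r subr0 normr0 expr0n mulr0.
rewrite -subr_eq0 => ts0.
have ts1 : 0 < (t - s) ^+ 2 by rewrite exprn_even_gt0.
have tsge : 0 <= t - s by rewrite subr_ge0.
pose G := [set v : 'rV[R]_d | exists2 a : E -> R, weights a &
  `|v - \sum_i a i *: F i (f s)| <= K * C * (t - s)].
have acst := abs_continuousS s0 (lexx t) (acf t (le_trans s0 st)).
have [|||k [a wa ka] h] := @abs_continuous_increment R d f s t G (F i0 (f s)) _ acst st _ _ _ ts1.
- move=> k l u [a wa ak] [a' wa' al] u01.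
  exists (fun i => u * a i + (1 - u) * a' i); first exact: weights_conv.
  have -> : \sum_i (u * a i + (1 - u) * a' i) *: F i (f s) =
      u *: (\sum_i a i *: F i (f s)) + (1 - u) *: (\sum_i a' i *: F i (f s)).
    rewrite !scaler_sumr -big_split/=; apply: eq_bigr => i _.
    by rewrite scalerDl !scalerA.
  rewrite opprD addrACA -!scalerBr (le_trans (ler_normD _ _))//.
  have /andP[u0 u1] := u01.
  rewrite !normrZ !ger0_norm ?subr_ge0//.
  have h1 := ler_wpM2l u0 ak.
  have h2 : (1 - u) * `|l - \sum_i a' i *: F i (f s)| <= (1 - u) * (K * C * (t - s)).
    by rewrite ler_wpM2l// subr_ge0.
  by lra.
- exists (fun i => (i == i0)%:R); first exact: weights1.
  rewrite (bigD1 i0)//= eqxx scale1r big1 ?addr0; last first.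
    by move=> i /negbTE ->; rewrite scale0r.
  by rewrite subrr normr0 !mulr_ge0.
- apply: filterS aef; first exact: (ae_filter_ringOfSetsType mu).
  move=> u hu /andP[su ut]; have [|v cv dv] := hu; first exact: le_trans su.
  exists v => //; have /convexifiedP[a wa ->] := cv; exists a => //.
  apply: weighted_dist_le => // i; apply: (le_trans (FK _ _ _ _ _)).
  + by apply: bd; [exact: le_trans su|exact: le_trans tb].
  + by apply: bd => //; exact: le_trans tb.
  + rewrite -mulrA ler_wpM2l// (le_trans (solution_lipschitz sf s0 su))//.
    by rewrite ler_wpM2l// lerD2r.
exists a => //.
have -> : f t - f s - (t - s) *: \sum_i a i *: F i (f s) =
    (f t - f s - (t - s) *: k) + (t - s) *: (k - \sum_i a i *: F i (f s)).
  by rewrite scalerBr addrA subrK.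
rewrite (le_trans (ler_normD _ _))// normrZ (ger0_norm tsge).
have := ler_wpM2l tsge ka; lra.
Qed.

Lemma lipschitz_abs_continuous (f : R -> 'rV[R]_d) (a b c : R) :
  (forall s t, s <= t -> `|f t - f s| <= c * (t - s)) -> abs_continuous a b f.
Proof.
move=> fc e e0; pose c' := `|c| + 1.
have c'0 : 0 < c' by rewrite ltr_pwDr.
exists (e / c'); first by rewrite divr_gt0.
move=> n l r lr _; rewrite ltr_pdivlMr// => h.
apply: le_lt_trans h; rewrite mulr_suml; apply: ler_sum => i _.
have [_ lri _] := lr i.
rewrite (le_trans (fc _ _ lri))// mulrC ler_wpM2l ?subr_ge0//.
by rewrite (le_trans (ler_norm _))// lerDl.
Qed.

(** At a point t where f is differentiable, dividing the expansion from t to t + h by h puts the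
    derivative at a distance O(h) + o(1) from co(F)(f t), which is closed. *)
Lemma frozen_expansion_solution (f : R -> 'rV[R]_d) (c : R) :
  (forall s t, s <= t -> `|f t - f s| <= c * (t - s)) ->
  (forall b, 0 <= b -> exists L, frozen_expansion F b L f) ->
  is_solution F f.
Proof.
move=> fc fF; split=> [b _|]; first exact: lipschitz_abs_continuous fc.
have fc' x y : `|f x - f y| <= c * `|x - y|.
  have [xy|/ltW yx] := leP x y.
    by rewrite distrC (le_trans (fc _ _ xy))// distrC ger0_norm// subr_ge0.
  by rewrite (le_trans (fc _ _ yx))// ger0_norm// subr_ge0.
(* Coordinates are indexed by all natural numbers, in the form taken by [ae_foralln]; beyond d the
   statement is empty. *)
have ae_coord (j : nat) : {ae mu, forall t, forall k : 'I_d, k = j :> nat ->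
    derivable (fun s => f s ord0 k) t 1}.
  have [jd|jd] := ltnP j d; last first.
    apply: aeW => t k kj; have := ltn_ord k; rewrite kj ltnNge jd//.
  have := @lipschitz_ae_derivable R (fun s => f s ord0 (Ordinal jd)) c.
  move=> h; apply: filterS (h _); first exact: (ae_filter_ringOfSetsType mu).
    by move=> t dt k kj; rewrite (_ : k = Ordinal jd)//; exact: val_inj.
  move=> x y; have := coord_norm_le (f x - f y) (Ordinal jd).
  by rewrite !mxE => /le_trans; apply.
have : {ae mu, forall t, forall j : nat, forall k : 'I_d, k = j :> nat ->
    derivable (fun s => f s ord0 k) t 1} by exact: ae_foralln.
apply: filterS; first exact: (ae_filter_ringOfSetsType mu).
move=> t dft t0.
have df : derivable f t 1 by apply/derivable_mxP => i k; rewrite ord1; exact: dft.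
exists ('D_1 f t); last exact: derivableP.
have [L fL] := fF (t + 1) (addr_ge0 t0 ler01).
apply: convexified_closed => e e0.
have e20 : 0 < e / 2 by rewrite divr_gt0.
have [del del0 hd] := is_derive_approx (derivableP df) e20.
(* The bound 1 keeps t + h in the range of the expansion, del / 2 makes the derivative estimate
   available, and the last one gives L h <= e / 2. *)
pose h := Num.min (Num.min 1 (del / 2)) (e / 2 / (`|L| + 1)).
have L0 : 0 < `|L| + 1 by rewrite ltr_pwDr.
have h0 : 0 < h by rewrite /h !lt_min ltr01 !divr_gt0.
have h1 : h <= 1 by rewrite /h !ge_min lexx.
have h2 : h <= del / 2 by rewrite /h !ge_min lexx orbT.
have h3 : h <= e / 2 / (`|L| + 1) by rewrite /h !ge_min lexx !orbT.
have [|||a wa ha] := fL t (t + h) => //.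
- by rewrite lerDl ltW.
- by rewrite lerD2l.
exists a => //; have := hd (t + h).
have thE : t + h - t = h by rewrite addrAC subrr add0r.
rewrite thE in ha *; rewrite (gtr0_norm h0) => hd'.
rewrite -(ler_pM2l h0) -{1}(gtr0_norm h0) -normrZ.
have -> : h *: ('D_1 f t - \sum_i a i *: F i (f t)) =
    (f (t + h) - f t - h *: \sum_i a i *: F i (f t)) - (f (t + h) - f t - h *: 'D_1 f t).
  by rewrite scalerBr; apply/rowP => i; rewrite !mxE; ring.
rewrite (le_trans (ler_normB _ _))//.
have hL : L * h ^+ 2 <= e / 2 * h.
  rewrite expr2 mulrA ler_wpM2r ?(ltW h0)//.
  move: h3; rewrite ler_pdivlMr// => /(le_trans _); apply.
  rewrite mulrC ler_wpM2l ?(ltW h0)// (le_trans (ler_norm _))// lerDl//.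
have : `|f (t + h) - f t - h *: 'D_1 f t| <= e / 2 * h by apply: hd'; lra.
lra.
Qed.

End solutions.

(** * The path space *)

Section cpath_topology.
Context {R : realType} {d : nat}.

Lemma time_ge0 (t : time R) : 0 <= \val t.
Proof. by case: t => t /= /set_mem. Qed.

Lemma insubd_timeE (t : R) : 0 <= t -> \val (insubd (@time0 R) t) = t.
Proof. by move=> t0; rewrite insubdK//; exact: mem_set. Qed.

Lemma insubd_timeN (t : R) : t < 0 -> insubd (@time0 R) t = time0.
Proof.
move=> t0; rewrite /insubd insubN//; apply/negP => /set_mem/=.
by rewrite leNgt t0.
Qed.

Lemma extend_pathE (V : Type) (eta : time R -> V) (t : time R) :
  extend_path eta (\val t) = eta t.
Proof. by rewrite /extend_path valKd. Qed.

Lemma extend_path0 (V : Type) (eta : time R -> V) : extend_path eta 0 = eta time0.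
Proof. exact: (extend_pathE eta time0). Qed.

Lemma val_time_continuous : continuous (val : time R -> R).
Proof. exact: initial_continuous. Qed.

Lemma insubd_time_continuous :
  continuous (fun t : R => insubd (@time0 R) (Num.max 0 t) : time R).
Proof.
apply: continuous_comp_initial.
have -> : set_val \o (fun t : R => insubd (@time0 R) (Num.max 0 t)) =
    (fun t : R => Num.max 0 t).
  by apply/funext => t /=; rewrite set_valE/= insubd_timeE// le_max lexx.
move=> t; apply: (@continuous_max R R (cst 0) id t); [exact: cst_continuous|exact: cvg_id].
Qed.

Lemma time_segment_compact (b : R) : compact [set t : time R | \val t <= b].
Proof.
have -> : [set t : time R | \val t <= b] =
    (fun t : R => insubd (@time0 R) (Num.max 0 t) : time R) @` `[0, b]%classic.
  apply/seteqP; split=> [t /= tb|_ [t /=] + <-].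
    exists (\val t); first by rewrite /= in_itv/= time_ge0.
    by rewrite max_r ?time_ge0// valKd.
  by rewrite in_itv/= => /andP[t0 tb]; rewrite max_r// insubd_timeE.
apply: continuous_compact; last exact: segment_compact.
apply: continuous_subspaceT; exact: insubd_time_continuous.
Qed.

Lemma time_compact_bounded (K : set (time R)) : compact K ->
  exists b : R, forall t, K t -> \val t <= b.
Proof.
move=> cK; have : compact (val @` K).
  by apply: continuous_compact cK; apply: continuous_subspaceT; exact: val_time_continuous.
move=> /compact_bounded[B [_ BK]]; exists (`|B| + 1) => t Kt.
rewrite (le_trans (ler_norm _))//; apply: (BK (`|B| + 1)); last by exists t.
by rewrite ltr_pwDr// ler_norm.
Qed.

Definition tube (eta : cpath R d) (b e : R) : set (cpath R d) :=
  [set zeta | forall t : time R, \val t <= b -> `|zeta t - eta t| < e].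

Lemma nbhs_tube (eta : cpath R d) (b e : R) : 0 < e -> nbhs eta (tube eta b e).
Proof.
move=> e0; pose K := [set t : time R | \val t <= b].
pose En := [set xy : 'rV[R]_d * 'rV[R]_d | ball xy.1 e xy.2].
have entE : entourage En by rewrite -entourage_ballE; exists e.
have := @fam_nbhs _ _ compact K En
  (eta : {family compact, time R -> 'rV[R]_d}) entE (@time_segment_compact b).
move=> /(@initial_continuous (cpath R d) {family compact, time R -> 'rV[R]_d}
  (id : continuousType (time R) 'rV[R]_d -> _) eta).
move=> N; have {}N : nbhs eta [set zeta : cpath R d |
  forall y, K y -> En (eta y, zeta y)] by exact: N.
apply: filterS N => zeta /= h t tb; have := h t tb.
by rewrite /En/= -ball_normE /ball_/= distrC.
Qed.

(** Compact sets of times are bounded, so the filter generated by the tubes converges to eta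
    uniformly on compact sets; every neighbourhood therefore contains a tube. *)
Lemma tube_basis (eta : cpath R d) (A : set (cpath R d)) : nbhs eta A ->
  exists b e : R, 0 < e /\ tube eta b e `<=` A.
Proof.
move=> [_ [[B oB <-] Beta] BA].
pose G : set_system (time R -> 'rV[R]_d) :=
  filter_from [set be : R * R | 0 < be.2] (fun be => [set g : time R -> 'rV[R]_d |
    forall t, \val t <= be.1 -> `|g t - eta t| < be.2]).
have FG : Filter G.
  apply: filter_from_filter; first by exists (0, 1) => /=.
  move=> [b e] [b' e'] /= e0 e0'; exists (Num.max b b', Num.min e e') => /=.
    by rewrite lt_min e0.
  by move=> g h; split=> t tb; have := h t; rewrite le_max tb ?orbT lt_min => /(_ erefl)/andP[].
have : {family compact, G --> (eta : time R -> 'rV[R]_d)}.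
  apply/fam_cvgP => K cK P /uniform_nbhs[En [entE EP]].
  have [b Kb] := time_compact_bounded cK.
  move: entE; rewrite -entourage_ballE => -[e /= e0 eE].
  exists (b, e) => //= g h; apply: EP => t Kt; apply: eE => /=.
  by rewrite -ball_normE /ball_/= distrC; apply: h; exact: Kb.
move=> /(_ B)[|[b e] /= e0 h].
  by apply: open_nbhs_nbhs; split.
by exists b, e; split => // zeta hz; apply: BA; exact: h.
Qed.

End cpath_topology.

Section inclusion_solutions_closed.
Context {R : realType} {d : nat} {E : finType}.
Context (F : E -> 'rV[R]_d -> 'rV[R]_d) (C : R) (i0 : E).
Hypothesis C_ge0 : 0 <= C.
Hypothesis F_le : forall i x, `|F i x| <= C.
Hypothesis F_smooth : forall i, smooth (F i).

Lemma lipschitz_all_modes (r : R) : exists2 K, 0 <= K &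
  forall i x y, `|x| <= r -> `|y| <= r -> `|F i x - F i y| <= K * `|x - y|.
Proof.
have : forall i, exists K, 0 <= K /\
    forall x y, `|x| <= r -> `|y| <= r -> `|F i x - F i y| <= K * `|x - y|.
  by move=> i; have [K K0 h] := smooth_lipschitz_ball r (F_smooth i); exists K.
move=> /choice[K KP]; exists (\sum_i K i) => [|i x y xr yr].
  by apply: sumr_ge0 => i _; case: (KP i).
have [_ h] := KP i; rewrite (le_trans (h _ _ xr yr))// ler_wpM2r//.
by rewrite (bigD1 i)//= lerDl sumr_ge0// => j _; case: (KP j).
Qed.

Lemma inclusion_solutionsP x (eta : cpath R d) :
  inclusion_solutions F x eta <->
  is_solution F (extend_path eta) /\ eta time0 = x.
Proof. by split=> [[]|[[]]]. Qed.

(** The extension by a constant keeps the Lipschitz bound on the whole line, where the theorem on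
    almost everywhere differentiability is stated. *)
Lemma extend_path_lipschitz (eta : time R -> 'rV[R]_d) :
  (forall s t, 0 <= s -> s <= t ->
     `|extend_path eta t - extend_path eta s| <= C * (t - s)) ->
  forall s t, s <= t -> `|extend_path eta t - extend_path eta s| <= C * (t - s).
Proof.
move=> h s t st; have [s0|s0] := leP 0 s; first exact: h.
have es : extend_path eta s = extend_path eta 0.
  by rewrite extend_path0 /extend_path insubd_timeN.
have [t0|t0] := leP 0 t.
  rewrite es (le_trans (h _ _ (lexx 0) t0))// ler_wpM2l//; lra.
rewrite /extend_path !insubd_timeN// subrr normr0 mulr_ge0// subr_ge0//.
Qed.

Lemma inclusion_solutions_closed x : closed (@inclusion_solutions R d E F x).
Proof.
move=> eta cl; apply/inclusion_solutionsP.
pose f := extend_path eta.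
have close (b e : R) : 0 < e -> exists g, [/\ is_solution F g, g 0 = x &
    forall t, 0 <= t -> t <= b -> `|g t - f t| < e].
  move=> e0; have [zeta [/inclusion_solutionsP[sz zx] hz]] := cl _ (nbhs_tube eta b e0).
  exists (extend_path zeta); split => //.
    by rewrite extend_path0.
  move=> t t0 tb; apply: hz; by rewrite insubd_timeE.
have eta0 : eta time0 = x.
  apply/eqP; rewrite -subr_eq0 -normr_le0; apply/ler_addgt0Pr => e e0.
  have [g [_ gx gf]] := close 0 e e0.
  have := gf 0 (lexx 0) (lexx 0).
  by rewrite gx distrC /f extend_path0 add0r => /ltW.
have fL s t : s <= t -> `|f t - f s| <= C * (t - s).
  apply: extend_path_lipschitz => {}s {}t s0 st; apply/ler_addgt0Pr => e e0.
  have e20 : 0 < e / 2 by rewrite divr_gt0.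
  have [g [sg gx gf]] := close t (e / 2) e20.
  have h1 := gf s s0 st; have h2 := gf t (le_trans s0 st) (lexx t).
  have h3 := solution_lipschitz C_ge0 F_le sg s0 st.
  rewrite -/f (_ : f t - f s = (g t - g s) - (g t - f t) + (g s - f s)); last first.
    by apply/rowP => i; rewrite !mxE; ring.
  rewrite (le_trans (ler_normD _ _))//.
  have := ler_normB (g t - g s) (g t - f t).
  lra.
split; last exact: eta0.
apply: (frozen_expansion_solution fL) => b b0.
pose r := `|x| + C * b.
have [K K0 FK] := lipschitz_all_modes r.
exists (K * C + 1 + 1) => s t s0 st tb.
have [ts|] := eqVneq t s.
  exists (fun i => (i == i0)%:R); first exact: weights1.
  by rewrite ts !subrr scale0r subr0 normr0 expr0n mulr0.
rewrite -subr_eq0 => ts0.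
have ts1 : 0 < (t - s) ^+ 2 by rewrite exprn_even_gt0.
have ts2 : 0 <= t - s by rewrite subr_ge0.
(* Replacing f by a solution g at distance less than e costs e at each of s and t, and (t - s) K e
   in the fields, hence D e in all. With e = (t - s)^2 / D the constant of g increases by 1 only.
   The solution g depends on s and t, but its constant does not. *)
pose D := 2 + (t - s) * K.
have D0 : 0 < D by rewrite ltr_pwDl// mulr_ge0.
have De0 : 0 < (t - s) ^+ 2 / D by rewrite divr_gt0.
have [g [sg gx gf]] := close b _ De0.
have b0' : `|g 0| + C * b <= r by rewrite gx.
have [a wa ga] := solution_frozen_expansion C_ge0 F_le i0 sg K0 b0' FK s0 st tb.
exists a => //.
have sb : s <= b := le_trans st tb.
have t0 : 0 <= t := le_trans s0 st.
have bd (p : R -> 'rV[R]_d) : p 0 = x -> `|p s - p 0| <= C * (s - 0) -> `|p s| <= r.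
  move=> px; rewrite px subr0 => h; rewrite -[p s](subrK x) (le_trans (ler_normD _ _))//.
  by rewrite addrC lerD2l (le_trans h)// ler_wpM2l.
have fs : `|f s| <= r.
  by apply: bd; [rewrite /f extend_path0|exact: fL].
have gs : `|g s| <= r by apply: bd => //; exact: (solution_lipschitz C_ge0 F_le sg).
have h1 := gf s s0 sb; have h2 := gf t t0 tb.
have h3 : `|\sum_i a i *: F i (g s) - \sum_i a i *: F i (f s)| <= K * `|g s - f s|.
  by apply: weighted_dist_le => // i; exact: FK.
rewrite -/f.
set Sf := \sum_i a i *: F i (f s) in h3 *; set Sg := \sum_i a i *: F i (g s) in h3 ga *.
have -> : f t - f s - (t - s) *: Sf = (g t - g s - (t - s) *: Sg) - (g t - f t)
   + (g s - f s) + (t - s) *: (Sg - Sf).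
  by rewrite scalerBr; apply/rowP => i; rewrite !mxE; ring.
have n1 := ler_normD ((g t - g s - (t - s) *: Sg) - (g t - f t) + (g s - f s))
  ((t - s) *: (Sg - Sf)).
have n2 := ler_normD ((g t - g s - (t - s) *: Sg) - (g t - f t)) (g s - f s).
have n3 := ler_normB (g t - g s - (t - s) *: Sg) (g t - f t).
rewrite normrZ (ger0_norm ts2) in n1.
have h4 : (t - s) * `|Sg - Sf| <= (t - s) * K * ((t - s) ^+ 2 / D).
  rewrite -mulrA ler_wpM2l// (le_trans h3)// ler_wpM2l//; exact: ltW.
have : D * ((t - s) ^+ 2 / D) = (t - s) ^+ 2 by rewrite mulrC divfK// gt_eqF.
rewrite {1}/D mulrDl; lra.
Qed.

End inclusion_solutions_closed.

(** * Paths of the process *)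

Section switched_path.
Context {R : realType} {d : nat} {E : finType}.
Context (F : E -> 'rV[R]_d -> 'rV[R]_d) (C : R).
Hypothesis C_ge0 : 0 <= C.
Hypothesis F_le : forall i x, `|F i x| <= C.
Context (Phi : E -> R -> 'rV[R]_d -> 'rV[R]_d).
Hypothesis F_flow : forall i, is_flow (F i) (Phi i).
Context (T : nat -> R) (z : nat -> 'rV[R]_d * E) (p : time R -> 'rV[R]_d).
Hypothesis T0 : T 0%N = 0.
Hypothesis T_lt : forall n, T n < T n.+1.
Hypothesis T_cover : forall t, 0 <= t -> exists n, T n <= t < T n.+1.
Hypothesis zS : forall n, (z n.+1).1 = Phi (z n).2 (T n.+1 - T n) (z n).1.
Hypothesis pE : forall t n, T n <= \val t < T n.+1 ->
  p t = Phi (z n).2 (\val t - T n) (z n).1.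

Lemma switch_time_le m n : (m <= n)%N -> T m <= T n.
Proof.
elim: n => [|n ih]; first by rewrite leqn0 => /eqP ->.
rewrite leq_eqVlt => /predU1P[->//|]; rewrite ltnS => /ih mn.
exact: le_trans mn (ltW (T_lt n)).
Qed.

Lemma switch_time_ge0 n : 0 <= T n.
Proof. by rewrite -T0 switch_time_le. Qed.

(** The right endpoint is included: the flow started at the n-th switch arrives there at the next
    position. Consecutive formulas thus overlap, which makes the path continuous. *)
Lemma switched_pathE n t : T n <= t <= T n.+1 ->
  extend_path p t = Phi (z n).2 (t - T n) (z n).1.
Proof.
move=> /andP[nt]; have t0 := le_trans (switch_time_ge0 n) nt.
rewrite le_eqVlt => /predU1P[->|tn]; last first.
  by rewrite /extend_path (@pE _ n) insubd_timeE// nt tn.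
rewrite /extend_path (@pE _ n.+1) insubd_timeE ?switch_time_ge0 ?lexx//.
  by rewrite subrr (F_flow _).1 zS.
exact: T_lt.
Qed.

Lemma switched_path_switch n : extend_path p (T n) = (z n).1.
Proof.
by rewrite (@switched_pathE n) ?lexx ?ltW//= subrr (F_flow _).1.
Qed.

Lemma switched_path_lipschitz s t : s <= t ->
  `|extend_path p t - extend_path p s| <= C * (t - s).
Proof.
apply: extend_path_lipschitz => // {}s {}t s0 st.
have piece k u v : T k <= u -> u <= v -> v <= T k.+1 ->
    `|extend_path p v - extend_path p u| <= C * (v - u).
  move=> ku uv vk; rewrite (@switched_pathE k v) ?vk ?(le_trans ku uv)//.
  rewrite (@switched_pathE k u) ?ku ?(le_trans uv vk)//.
  rewrite (le_trans (flow_lipschitz (F_le _) (F_flow _) _ _ _))//.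
  by rewrite opprB addrA subrK ger0_norm// subr_ge0.
have [m /andP[ms sm]] := T_cover s0.
suff H n : (m <= n)%N -> forall v, s <= v -> T n <= v -> v <= T n.+1 ->
    `|extend_path p v - extend_path p s| <= C * (v - s).
  have [n /andP[nt tn]] := T_cover (le_trans s0 st).
  apply: (H n) => //; last exact: ltW.
  rewrite leqNgt; apply/negP => nm.
  by have := switch_time_le nm; rewrite leNgt (le_lt_trans ms (le_lt_trans st tn)).
elim: n => [|n ih] mn v sv nv vn.
  by apply: (@piece 0%N) => //; move: mn; rewrite leqn0 => /eqP mE; rewrite -mE.
move: mn; rewrite leq_eqVlt => /predU1P[mE|].
  by apply: (@piece n.+1) => //; rewrite -mE.
rewrite ltnS => mn.
have sn : s <= T n.+1.
  by apply: (le_trans (ltW sm)); exact: switch_time_le.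
have h1 := ih mn (T n.+1) sn (ltW (T_lt n)) (lexx _).
have h2 := @piece n.+1 (T n.+1) v (lexx _) nv vn.
rewrite -[_ - _](subrKA (extend_path p (T n.+1))) (le_trans (ler_normD _ _))//.
by rewrite -[v - s](subrKA (T n.+1)) mulrDr lerD.
Qed.

Lemma switched_path_continuous : continuous p.
Proof.
have -> : p = extend_path p \o (val : time R -> R).
  by apply/funext => t /=; rewrite extend_pathE.
move=> t; apply: continuous_comp; first exact: val_time_continuous.
apply/(@cvgrPdist_le _ _ _ (nbhs (\val t))) => e e0.
have c0 : 0 < C + 1 by rewrite ltr_pwDr.
near=> s.
have h : `|extend_path p (\val t) - extend_path p s| <= C * `|\val t - s|.
  have [st|/ltW ts] := leP s (\val t).
    by rewrite (le_trans (switched_path_lipschitz st))// ger0_norm// subr_ge0.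
  rewrite distrC (le_trans (switched_path_lipschitz ts))// distrC ger0_norm//.
  by rewrite subr_ge0.
rewrite (le_trans h)// (@le_trans _ _ ((C + 1) * `|\val t - s|))//.
  by rewrite ler_wpM2r// lerDl.
rewrite mulrC -ler_pdivlMr//.
by near: s; apply: cvgr_dist_le => //; rewrite divr_gt0.
Unshelve. all: by end_near. Qed.

Lemma is_derive_shifted_flow i x (c t : R) :
  is_derive t 1 (fun s : R => Phi i (s - c) x) (F i (Phi i (t - c) x)).
Proof.
have [df dF] := (F_flow i).2 (t - c) x.
have e : (fun h : R => h^-1 *: (Phi i (h *: 1 + t - c) x - Phi i (t - c) x)) =
    (fun h : R => h^-1 *: (Phi i (h *: 1 + (t - c)) x - Phi i (t - c) x)).
  by apply/funext => h; rewrite addrA.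
apply: DeriveDef; first by rewrite /derivable/= e.
by rewrite /derive/= e.
Qed.

(** The exceptional set is the countable set of switching times; elsewhere the path follows a single
    flow, and the weights are concentrated on the current mode. *)
Lemma switched_path_solution : is_solution F (extend_path p).
Proof.
split=> [b _|]; first exact: lipschitz_abs_continuous switched_path_lipschitz.
have cT : countable (range T) by apply: card_image_le.
exists (range T); split.
- by apply: countable_measurable.
- exact: countable_lebesgue_measure0.
move=> t /= h; apply: contrapT => tT; apply: h => t0.
have [n /andP[nt tn]] := T_cover t0.
have ntlt : T n < t.
  by rewrite lt_neqAle nt andbT; apply/eqP => nE; apply: tT; exists n.
have fE : \forall s \near t, Phi (z n).2 (s - T n) (z n).1 = extend_path p s.
  near=> s; rewrite (@switched_pathE n)//; apply/andP; split.
    by apply: ltW; near: s; exact: lt_nbhsr.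
  by apply: ltW; near: s; exact: lt_nbhsl.
exists (F (z n).2 (extend_path p t)).
  exists (fun i => (i == (z n).2)%:R); split.
  - by move=> i; rewrite ler0n.
  - by rewrite (bigD1 (z n).2)//= eqxx big1 ?addr0// => i /negbTE ->.
  - rewrite (bigD1 (z n).2)//= eqxx scale1r big1 ?addr0// => i /negbTE ->.
    by rewrite scale0r.
rewrite (@switched_pathE n) ?nt ?ltW//.
apply: near_eq_is_derive fE _; exact: is_derive_shifted_flow.
Unshelve. all: by end_near. Qed.

End switched_path.

Lemma rat_row_approx {R : realType} {d : nat} (v : 'rV[R]_d) (e : R) : 0 < e ->
  exists q : 'rV[rat]_d, `|v - map_mx ratr q| < e.
Proof.
move=> e0; have e20 : 0 < e / 2 by rewrite divr_gt0.
have : forall j : 'I_d, exists q : rat, `|v 0 j - ratr q| < e / 2.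
  move=> j; have [|q] := @rat_in_itvoo R (v 0 j - e / 2) (v 0 j + e / 2); first lra.
  by rewrite in_itv/= => /andP[q1 q2]; exists q; rewrite ltr_norml; apply/andP; split; lra.
move=> /choice[q hq]; exists (\row_j q j).
rewrite (@le_lt_trans _ _ (e / 2))//; last lra.
apply: norm_le_coord => [|j]; first exact: ltW.
by rewrite !mxE ltW.
Qed.

(** * The random path and its measurability *)

Section process_paths.
Context {R : realType} {d : nat} {E : finType}.
Context (F : E -> 'rV[R]_d -> 'rV[R]_d) (Phi : E -> R -> 'rV[R]_d -> 'rV[R]_d).
Context (C : R).
Hypothesis C_ge0 : 0 <= C.
Hypothesis F_le : forall i x, `|F i x| <= C.
Hypothesis F_smooth : forall i, smooth (F i).
Hypothesis F_bounded : forall i, bounded_fun (F i).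
Hypothesis F_flow : forall i, is_flow (F i) (Phi i).
Context (M : set 'rV[R]_d).
Hypothesis M_invariant : forall i t x, 0 <= t -> M x -> M (Phi i t x).
Context (Q : 'rV[R]_d -> E -> E -> R) (lam : R).
Context (disp : measure_display) (Omega : measurableType disp).
Context (P : probability Omega R).
Context (N : time R -> Omega -> nat) (T : nat -> Omega -> R).
Hypothesis N_poisson : poisson_process P lam N T.
Context (Zt : nat -> Omega -> 'rV[R]_d * E).
Hypothesis Zt_chain : embedded_chain P Phi M Q N T Zt.
Context (Z : time R -> Omega -> 'rV[R]_d * E).
Hypothesis Z_interpolates : interpolates Phi T Zt Z.

Lemma jump_time_cover w t : 0 <= t -> exists n, T n w <= t < T n.+1 w.
Proof.
move=> t0; exists (N (insubd time0 t) w).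
have /(countingP N_poisson) := erefl (N (insubd time0 t) w).
by rewrite insubd_timeE.
Qed.

Lemma interarrival_gt0 n w : 0 < interarrival T n w.
Proof. by rewrite subr_gt0; exact: (jump_time_lt N_poisson). Qed.

Lemma chain_in_M n w : M (Zt n w).1.
Proof.
elim: n => [|n ih]; first exact: (embedded_init Zt_chain).
rewrite (embedded_flow Zt_chain); apply: M_invariant => //.
exact/ltW/interarrival_gt0.
Qed.

Lemma position_at w t n : T n w <= \val t < T n.+1 w ->
  (Z t w).1 = Phi (Zt n w).2 (\val t - T n w) (Zt n w).1.
Proof. by move=> h; rewrite (Z_interpolates h). Qed.

Let position_lipschitz w := @switched_path_lipschitz R d E F C C_ge0 F_le Phi F_flow
  (T ^~ w) (Zt ^~ w) (fun t => (Z t w).1) (jump_time0 N_poisson w)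
  ((jump_time_lt N_poisson)^~ w) (@jump_time_cover w) ((embedded_flow Zt_chain)^~ w)
  (@position_at w).

Let position_continuous w := @switched_path_continuous R d E F C C_ge0 F_le Phi F_flow
  (T ^~ w) (Zt ^~ w) (fun t => (Z t w).1) (jump_time0 N_poisson w)
  ((jump_time_lt N_poisson)^~ w) (@jump_time_cover w) ((embedded_flow Zt_chain)^~ w)
  (@position_at w).

Let position_solution w := @switched_path_solution R d E F C C_ge0 F_le Phi F_flow
  (T ^~ w) (Zt ^~ w) (fun t => (Z t w).1) (jump_time0 N_poisson w)
  ((jump_time_lt N_poisson)^~ w) (@jump_time_cover w) ((embedded_flow Zt_chain)^~ w)
  (@position_at w).

Let position_switch w := @switched_path_switch R d E F Phi F_flow
  (T ^~ w) (Zt ^~ w) (fun t => (Z t w).1) (jump_time0 N_poisson w)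
  ((jump_time_lt N_poisson)^~ w) ((embedded_flow Zt_chain)^~ w)
  (@position_at w).

Definition path_of (w : Omega) : cpath R d := mkcts (@position_continuous w).

Lemma path_of_lipschitz w s t : s <= t ->
  `|extend_path (path_of w) t - extend_path (path_of w) s| <= C * (t - s).
Proof. exact: position_lipschitz. Qed.

Lemma path_of_solution w : is_solution F (extend_path (path_of w)).
Proof. exact: position_solution. Qed.

Lemma path_of_switch w n : extend_path (path_of w) (T n w) = (Zt n w).1.
Proof. exact: position_switch. Qed.

Lemma path_of_dist w s t :
  `|extend_path (path_of w) t - extend_path (path_of w) s| <= C * `|t - s|.
Proof.
have [st|/ltW ts] := leP s t.
  by rewrite (le_trans (path_of_lipschitz w st))// ger0_norm// subr_ge0.
rewrite distrC (le_trans (path_of_lipschitz w ts))// distrC ger0_norm//.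
by rewrite subr_ge0.
Qed.

Lemma chain_dist m n w : `|(Zt n w).1 - (Zt m w).1| <= C * `|T n w - T m w|.
Proof. by rewrite -!path_of_switch path_of_dist. Qed.

Lemma measurable_jump_time n : measurable_fun setT (T n).
Proof.
elim: n => [|n ih].
  by rewrite (_ : T 0%N = cst 0)//; apply/funext => w; exact: (jump_time0 N_poisson).
rewrite (_ : T n.+1 = T n \+ interarrival T n); last first.
  by apply/funext => w; rewrite /interarrival/= addrC subrK.
by apply: measurable_funD => //; exact: (measurable_interarrival N_poisson).
Qed.

Lemma state_measurable_rect (A : set 'rV[R]_d) i : <<s @open 'rV[R]_d >> A ->
  state_measurable [set z : 'rV[R]_d * E | A z.1 /\ z.2 = i].
Proof.
move=> sA j; have [->|ji] := eqVneq j i.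
  by rewrite (_ : [set _ | _] = A)//; apply/seteqP; split => [x []|x].
rewrite (_ : [set _ | _] = set0); first exact: sigma_algebra0.
by apply/seteqP; split => // x [_ /= jE]; rewrite jE eqxx in ji.
Qed.

Lemma state_measurable_open (A : set 'rV[R]_d) i : open A ->
  state_measurable [set z : 'rV[R]_d * E | A z.1 /\ z.2 = i].
Proof. by move=> oA; apply: state_measurable_rect; exact: sub_sigma_algebra. Qed.

Lemma open_norm_lt (f : 'rV[R]_d -> 'rV[R]_d) v (e : R) : continuous f ->
  open [set x | `|f x - v| < e].
Proof.
move=> cf; apply: (@open_comp _ _ (fun x => `|f x - v|) [set r | r < e]); last exact: open_lt.
move=> x _; apply: (@continuous_comp _ _ _ (fun x => f x - v)).
  by apply: (@continuousB _ _ _ f (cst v)); [exact: cf|exact: cst_continuous].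
exact: norm_continuous.
Qed.

Lemma open_dist_lt (v : 'rV[R]_d) (e : R) : open [set x | `|x - v| < e].
Proof. by apply: (@open_norm_lt idfun) => x; exact: cvg_id. Qed.

(** Rounding the random elapsed time t - T_n to a rational r changes the position by at most C times
    the rounding error. The event becomes a countable union of events that bear separately on the
    jump times and on the n-th state, so continuity of each Phi i r in space is enough. *)
Lemma measurable_position_near (t : time R) v (e : R) :
  measurable [set w | `|(Z t w).1 - v| < e].
Proof.
pose I := (nat * E * rat * rat)%type.
pose B (k : I) : set Omega := let: (n, i, r, del) := k in
  [set w | T n w <= \val t < T n.+1 w /\ `|\val t - T n w - ratr r| < ratr del] `&`
  (if 0 <= r then Zt n @^-1` [set z | `|Phi i (ratr r) z.1 - v| < e - C * ratr del /\ z.2 = i]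
   else set0).
have -> : [set w | `|(Z t w).1 - v| < e] = \bigcup_k B k.
  apply/seteqP; split=> [w /= he|w [[[[n i] r] del] _ /=]].
    have [n tn] := jump_time_cover w (time_ge0 t).
    rewrite (position_at tn) in he.
    set i := (Zt n w).2 in he; set s := \val t - T n w in he.
    set u := (Zt n w).1 in he.
    have s0 : 0 <= s by rewrite subr_ge0; case/andP: tn.
    pose g := e - `|Phi i s u - v|.
    have g0 : 0 < g by rewrite subr_gt0.
    (* The rounding error is paid twice: in the radius e - C del, and when the rounded time is
       compared with the true one. *)
    have c1 : 0 < 2 * (C + 1) by rewrite mulr_gt0// ltr_pwDr.
    have [|del] := @rat_in_itvoo R 0 (g / (2 * (C + 1))); first by rewrite divr_gt0.
    rewrite in_itv/= => /andP[del0 delg].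
    have [|r] := @rat_in_itvoo R s (s + ratr del); first by rewrite ltrDl.
    rewrite in_itv/= => /andP[sr rs].
    have r0 : 0 <= ratr r :> R by rewrite (le_trans s0)// ltW.
    exists (n, i, r, del) => //; split => /=.
      by split => //; rewrite -/s ltr_norml; apply/andP; split; lra.
    rewrite -(ler0q R) r0; split => //=; rewrite -/u.
    have h1 : `|Phi i (ratr r) u - Phi i s u| <= C * ratr del.
      rewrite (le_trans (flow_lipschitz (F_le _) (F_flow _) _ _ _))//.
      by rewrite ler_wpM2l// ger0_norm; lra.
    have h2 := ler_normD (Phi i (ratr r) u - Phi i s u) (Phi i s u - v).
    rewrite addrA subrK in h2.
    move: delg; rewrite ltr_pdivlMr// /g => delg.
    have : ratr del * (2 * (C + 1)) = 2 * (C * ratr del) + 2 * ratr del :> R by ring.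
    lra.
  case: ifP => r0 [[tn hs] //= [hr iE]].
  rewrite (position_at tn) iE.
  have h1 : `|Phi i (\val t - T n w) (Zt n w).1 - Phi i (ratr r) (Zt n w).1| <= C * ratr del.
    rewrite (le_trans (flow_lipschitz (F_le _) (F_flow _) _ _ _))//.
    by rewrite ler_wpM2l// ltW.
  have h2 := ler_normD (Phi i (\val t - T n w) (Zt n w).1 - Phi i (ratr r) (Zt n w).1)
    (Phi i (ratr r) (Zt n w).1 - v).
  rewrite addrA subrK in h2; lra.
apply: countable_bigcupT_measurable => [|[[[n i] r] del]]; first exact: countableP.
rewrite /B; apply: measurableI.
  have mT := measurable_jump_time.
  have -> : [set w | T n w <= \val t < T n.+1 w /\ `|\val t - T n w - ratr r| < ratr del] =
      (T n @^-1` (`]-oo, \val t] `&` `](\val t - ratr r - ratr del), (\val t - ratr r + ratr del)[))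
      `&` (T n.+1 @^-1` `]\val t, +oo[).
    apply/seteqP; split=> w /=; rewrite !in_itv/= ?andbT.
      move=> [/andP[h1 h2]]; rewrite ltr_norml => /andP[h3 h4].
      by repeat split => //; apply/andP; split; lra.
    move=> [[h1 /andP[h2 h3]] h4]; split; first by rewrite h1 h4.
    by rewrite ltr_norml; apply/andP; split; lra.
  apply: measurableI; rewrite -[X in measurable X]setTI; apply: mT => //.
  by apply: measurableI; exact: measurable_itv.
case: ifP => r0; last exact: measurable0.
apply: (embedded_measurable Zt_chain).
apply: (@state_measurable_open [set x | `|Phi i (ratr r) x - v| < e - C * ratr del]).
apply: open_norm_lt; apply: (@flow_continuous _ _ (F i)) => //.
by rewrite ler0q.
Qed.

(** All paths are C-Lipschitz, hence known up to a small error from their values on a fine finite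
    grid. The events [B], where these values are close to given rational vectors, form a countable
    family, and the preimage of an open set is the union of those it contains. *)
Lemma measurable_path_of : measurable_fun setT (path_of : Omega -> borel_cpath R d).
Proof.
apply: (@measurability _ _ Omega (borel_cpath R d) setT path_of (@open (cpath R d))
  erefl) => _ [A oA <-].
rewrite setTI.
pose I := (nat * nat * seq 'rV[rat]_d)%type.
pose B (c : I) : set Omega := let: (m, k, q) := c in
  \bigcap_(j in [set j | (j < size q)%N])
    [set w | `|extend_path (path_of w) (j%:R / m.+1%:R) - map_mx ratr (nth 0 q j)| < k.+1%:R^-1].
pose good c := B c `<=` path_of @^-1` A.
have -> : path_of @^-1` A = \bigcup_c (if `[< good c >] then B c else set0).
  apply/seteqP; split=> [w Aw|w [c _]]; last first.
    by case: ifPn => // /asboolP; apply.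
  have [b [e [e0 tA]]] := tube_basis (open_nbhs_nbhs (conj oA Aw)).
  (* Two paths in the same event differ by four errors below e / 4: for each of them, the rounding
     at a grid point and the motion since that point. *)
  pose k := Num.bound (4 / e); pose m := Num.bound (4 * C / e).
  have k4 : k.+1%:R^-1 < e / 4 :> R.
    rewrite -[e / 4]invf_div ltf_pV2 ?posrE ?divr_gt0//.
    by rewrite (lt_le_trans (archi_boundP _)) ?divr_ge0 ?(ltW e0)// ler_nat.
  have m4 : C / m.+1%:R < e / 4.
    rewrite ltr_pdivrMr// mulrC -ltr_pdivrMr ?divr_gt0// invf_div mulrA [C * 4]mulrC.
    by rewrite (lt_le_trans (archi_boundP _)) ?divr_ge0 ?mulr_ge0 ?(ltW e0)// ler_nat.
  have k0 : 0 < k.+1%:R^-1 :> R by rewrite invr_gt0.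
  have [q hq] := choice (fun j : nat =>
    rat_row_approx (extend_path (path_of w) (j%:R / m.+1%:R)) k0).
  pose n := Num.bound (`|b| * m.+1%:R).
  exists (m, k, mkseq q n) => //.
  have Bw : B (m, k, mkseq q n) w.
    move=> j; rewrite /mkset size_mkseq => jn.
    by rewrite nth_mkseq.
  have gc : good (m, k, mkseq q n).
    move=> w' Bw'; apply: tA => t tb.
    pose j := Num.truncn (\val t * m.+1%:R).
    have tm0 : 0 <= \val t * m.+1%:R by rewrite mulr_ge0 ?time_ge0.
    have /andP[j1 j2] := truncn_itv tm0.
    have jn : (j < n)%N.
      rewrite -(@ltr_nat R) (le_lt_trans j1)//.
      rewrite (@le_lt_trans _ _ (`|b| * m.+1%:R))//; last first.
        by rewrite archi_boundP// mulr_ge0.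
      by rewrite ler_wpM2r// (le_trans tb)// ler_norm.
    have jn' : (j < size (mkseq q n))%N by rewrite size_mkseq.
    have h := Bw j jn'; have h' := Bw' j jn'.
    rewrite /mkset nth_mkseq// in h; rewrite /mkset nth_mkseq// in h'.
    set tj := j%:R / m.+1%:R in h h'.
    have tjt : tj <= \val t by rewrite /tj ler_pdivrMr.
    have ttj : \val t - tj <= m.+1%:R^-1.
      rewrite lerBlDr -[m.+1%:R^-1]mul1r -mulrDl ler_pdivlMr//.
      by rewrite addrC natr1 ltW.
    have L u : `|path_of u t - extend_path (path_of u) tj| <= C / m.+1%:R.
      rewrite -(extend_pathE (path_of u)) (le_trans (path_of_lipschitz u tjt))//.
      by rewrite ler_wpM2l.
    have := L w; have := L w'.
    set a := path_of w t; set a' := path_of w' t.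
    set c := extend_path (path_of w) tj in h *; set c' := extend_path (path_of w') tj in h' *.
    set qq := map_mx ratr (q j) in h h'.
    move=> L1 L2.
    have -> : a' - a = (a' - c') + (c' - qq) - (c - qq) - (a - c).
      by apply/rowP => l; rewrite !mxE; ring.
    have n1 := ler_normB ((a' - c') + (c' - qq) - (c - qq)) (a - c).
    have n2 := ler_normB ((a' - c') + (c' - qq)) (c - qq).
    have n3 := ler_normD (a' - c') (c' - qq).
    move: k4 m4 L1 L2 h h'; move: (C / m.+1%:R) (k.+1%:R^-1).
    move=> cm km k4 m4 L1 L2 h h'; lra.
  by rewrite asboolT.
apply: countable_bigcupT_measurable => [|[[m k] q]]; first exact: countableP.
case: ifP => _; last exact: measurable0.
apply: fin_bigcap_measurable => [|j _]; first exact: finite_II.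
have tj0 : 0 <= j%:R / m.+1%:R :> R by rewrite divr_ge0.
exact: measurable_position_near.
Qed.

End process_paths.

(** * Jump times and modes *)

Section generated_sigma_algebra.
Context {T : Type} (G : set (set T)).

Lemma gsigmaC A : <<s G >> A -> <<s G >> (~` A).
Proof.
by rewrite -setTD => sA; have [_ sD _] := @smallest_sigma_algebra T setT G; exact: sD.
Qed.

Lemma gsigma_bigcup (A : nat -> set T) :
  (forall n, <<s G >> (A n)) -> <<s G >> (\bigcup_n A n).
Proof. by have [_ _ sU] := @smallest_sigma_algebra T setT G; exact: sU. Qed.

Lemma gsigma_bigcap (A : nat -> set T) :
  (forall n, <<s G >> (A n)) -> <<s G >> (\bigcap_n A n).
Proof.
move=> sA; rewrite -[X in _ X]setCK setC_bigcap.
refine (gsigmaC _); refine (gsigma_bigcup _) => n; exact: gsigmaC.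
Qed.

Lemma gsigmaT : <<s G >> setT.
Proof.
have h : <<s G >> set0 by exact: sigma_algebra0.
by have := gsigmaC h; rewrite setC0.
Qed.

Lemma gsigmaI A B : <<s G >> A -> <<s G >> B -> <<s G >> (A `&` B).
Proof.
move=> sA sB; have -> : A `&` B = \bigcap_n (if n is 0%N then A else B).
  apply/seteqP; split=> [w [Aw Bw] [|n] _ //|w AB].
  by split; [exact: (AB 0%N I)|exact: (AB 1%N I)].
by refine (gsigma_bigcap _) => -[|n].
Qed.

End generated_sigma_algebra.

Lemma path_nseq {T : eqType} (e : rel T) (x : T) n : e x x -> path e x (nseq n x).
Proof. by move=> exx; elim: n => //= n ->; rewrite exx. Qed.

(** A path without repetition has fewer than #|T| edges; loops at its end pad it to a length that
    does not depend on i and j. *)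
Lemma connect_path_card {T : finType} (e : rel T) (i j : T) : reflexive e ->
  connect e i j -> exists p, [/\ path e i p, last i p = j & size p = #|T|].
Proof.
move=> er /connectP[p ep ->]; case/shortenP: ep => p' ep' up' _.
have sp' : (size p' <= #|T|)%N.
  have h : (#|i :: p'| <= #|T|)%N := max_card _.
  by move: h; rewrite (card_uniqP up') => /ltnW.
exists (p' ++ nseq (#|T| - size p') (last i p')); split.
- by rewrite cat_path ep' path_nseq.
- rewrite last_cat; elim: (_ - _)%N => //= n.
- by rewrite size_cat size_nseq subnKC.
Qed.

Section exponential_intervals.
Context {R : realType} (lam : R).
Hypothesis lam_gt0 : 0 < lam.

Lemma exponential_prob_itv_gt0 (a b : R) : 0 < a -> a < b ->
  (0 < exponential_prob lam `]a, b]%classic)%E.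
Proof.
move=> a0 ab; have b0 := lt_trans a0 ab.
have := exponential_prob_itv0c lam b0.
have -> : `[0, b]%classic = `[0, a]%classic `|` `]a, b]%classic :> set R.
  apply/seteqP; split=> x /=; rewrite !in_itv/=.
    by move=> /andP[x0 xb]; case: (leP x a) => xa; [left|right]; apply/andP.
  by move=> [/andP[x0 xa]|/andP[ax xb]]; apply/andP; split => //; lra.
rewrite {1}/exponential_prob ge0_integral_setU//=.
- rewrite -/(exponential_prob lam `[0, a]%classic) -/(exponential_prob lam `]a, b]%classic).
  rewrite exponential_prob_itv0c// => h.
  have : (0 < (1 - (expR (- lam * b))%:E) - (1 - (expR (- lam * a))%:E))%E.
    rewrite -!EFinB lte_fin subr_gt0 ltrD2l ltrN2 ltr_expR.
    by rewrite !mulNr ltrN2 ltr_pM2l.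
  by rewrite -h addeC addeA [X in (X + _)%E]addeC subee// add0e.
- apply/measurable_EFinP; apply: measurable_funTS; exact: measurable_exponential_pdf.
- by move=> x _; rewrite lee_fin exponential_pdf_ge0// ltW.
- apply/disj_setPLR => x /=; rewrite !in_itv/= => /andP[_ xa].
  by rewrite ltNge xa.
Qed.

End exponential_intervals.

Section jump_times_near_schedule.
Context {R : realType} (lam : R).
Hypothesis lam_gt0 : 0 < lam.
Context (disp : measure_display) (Omega : measurableType disp).
Context (P : probability Omega R).
Context (N : time R -> Omega -> nat) (T : nat -> Omega -> R).
Hypothesis N_poisson : poisson_process P lam N T.

Definition on_schedule (s : nat -> R) (del : R) (m : nat) : set Omega :=
  [set w | forall n, (n <= m)%N -> `|T n w - s n| < del].

Lemma jump_time_le_counting n (t : time R) w : (T n w <= \val t) = (n <= N t w)%N.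
Proof.
have /(countingP N_poisson)/andP[h1 h2] := erefl (N t w).
have mono a b : (a <= b)%N -> T a w <= T b w.
  elim: b => [|b ih]; first by rewrite leqn0 => /eqP ->.
  rewrite leq_eqVlt => /predU1P[->//|]; rewrite ltnS => /ih ab.
  exact: le_trans ab (ltW (jump_time_lt N_poisson b w)).
apply/idP/idP => [nt|nN]; last exact: le_trans (mono _ _ nN) h1.
rewrite leqNgt; apply/negP => Nn.
by have := mono _ _ Nn; rewrite leNgt (le_lt_trans nt h2).
Qed.

Lemma jump_time_ge0 n w : 0 <= T n w.
Proof.
elim: n => [|n ih]; first by rewrite (jump_time0 N_poisson).
exact: le_trans ih (ltW (jump_time_lt N_poisson n w)).
Qed.

Lemma sigma_counting_jump_le n (t : R) : sigma_counting N [set w | T n w <= t].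
Proof.
have [t0|t0] := leP 0 t; last first.
  rewrite (_ : [set _ | _] = set0); first exact: sigma_algebra0.
  by apply/seteqP; split => // w /= nt; have := jump_time_ge0 n w; lra.
apply: sub_sigma_algebra; exists (insubd time0 t) => //=.
exists [set k | (n <= k)%N] => //; rewrite setTI.
by apply/seteqP; split=> w /=; rewrite -jump_time_le_counting insubd_timeE.
Qed.

(** Measurability alone would not do: an event of [sigma_counting] is independent of Z_0 and belongs
    to every [sigma_past]. The strict upper bound on T_n is a countable union of events T_n <= t. *)
Lemma sigma_counting_on_schedule s del m : sigma_counting N (on_schedule s del m).
Proof.
have -> : on_schedule s del m = \bigcap_n (if (n <= m)%N then
    ~` [set w | T n w <= s n - del] `&` ~` (\bigcap_k ~` [set w | T n w <= s n + del - k.+1%:R^-1])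
    else setT).
  apply/seteqP; split=> w h n => [_|nm].
    case: ifP => // nm; have := h n nm; rewrite ltr_norml => /andP[h1 h2].
    split; first by move=> /= h3; lra.
    have [k hk] : exists k : nat, k.+1%:R^-1 < s n + del - T n w.
      have g0 : 0 < s n + del - T n w by lra.
      exists (Num.bound (s n + del - T n w)^-1).
      rewrite -[ltRHS]invrK ltf_pV2 ?posrE ?invr_gt0//.
      by rewrite (lt_le_trans (archi_boundP _)) ?invr_ge0 ?(ltW g0)// ler_nat.
    move=> hall; apply: (hall k I) => /=; move: hk; move: (k.+1%:R^-1) => r hk; lra.
  have := h n I; rewrite nm => -[/= h1 h2].
  rewrite ltr_norml; apply/andP; split; first by move/negP: h1; rewrite -ltNge; lra.
  rewrite ltNge; apply/negP => h3; apply: h2 => k _ /= h4.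
  have : 0 < k.+1%:R^-1 :> R by rewrite invr_gt0.
  by move: h4; move: (k.+1%:R^-1) => r h4 r0; lra.
refine (gsigma_bigcap _) => n; case: ifP => _; last exact: gsigmaT.
refine (gsigmaI (gsigmaC _) (gsigmaC _)); first exact: sigma_counting_jump_le.
refine (gsigma_bigcap _) => k; refine (gsigmaC _); exact: sigma_counting_jump_le.
Qed.

Lemma measurable_sigma_counting A : sigma_counting N A -> measurable A.
Proof.
apply: smallest_sub; first exact: sigma_algebra_measurable.
move=> _ [t _ [B _ <-]]; rewrite setTI.
have -> : N t @^-1` B = \bigcup_(n in B) [set w | T n w <= \val t < T n.+1 w].
  apply/seteqP; split=> w => [BN|[n Bn /= /(countingP N_poisson) h]].
    by exists (N t w) => //; exact/(countingP N_poisson).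
  by rewrite /preimage/= h.
apply: bigcup_measurable => n _.
have mT k : measurable_fun setT (T k) by exact: measurable_jump_time N_poisson k.
have -> : [set w | T n w <= \val t < T n.+1 w] =
    (T n @^-1` `]-oo, \val t]) `&` (T n.+1 @^-1` `]\val t, +oo[).
  apply/seteqP; split=> w /=; rewrite !in_itv/= ?andbT; last by move=> [-> ->].
  by move=> /andP[].
by apply: measurableI; rewrite -[X in measurable X]setTI; apply: mT => //; exact: measurable_itv.
Qed.

(** Each interarrival time is asked to exceed its planned value by at most del / (m + 1), so that
    the delays accumulated over m jumps stay below del; independence multiplies the positive
    probabilities. *)
Lemma on_schedule_gt0 s del m : s 0%N = 0 -> (forall n, s n < s n.+1) -> 0 < del ->
  (0 < P (on_schedule s del m))%E.
Proof.
move=> s0 ss del0; pose e := del / m.+1%:R.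
have e0 : 0 < e by rewrite divr_gt0.
pose A (k : 'I_m) : set R := `](s k.+1 - s k), (s k.+1 - s k + e)]%classic.
have mA k : measurable (A k) by exact: measurable_itv.
have sub : \bigcap_(k : 'I_m) (interarrival T k @^-1` A k) `<=` on_schedule s del m.
  move=> w hw n nm.
  suff : 0 <= T n w - s n <= n%:R * e.
    move=> /andP[h1 h2]; rewrite ger0_norm// (le_lt_trans h2)// /e mulrA.
    by rewrite ltr_pdivrMr// mulrC ltr_pM2l// ltr_nat ltnS.
  elim: n nm => [|n ih] nm; first by rewrite (jump_time0 N_poisson) s0 subrr mul0r lexx.
  have := ih (ltnW nm).
  have : interarrival T n w \in `](s n.+1 - s n), (s n.+1 - s n + e)] := hw (Ordinal nm) I.
  rewrite in_itv/= /interarrival => /andP[h1 h2] /andP[h3 h4].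
  by rewrite -natr1 mulrDl mul1r; apply/andP; split; lra.
have mB : measurable (\bigcap_(k : 'I_m) (interarrival T k @^-1` A k)).
  apply: fin_bigcap_measurable => [|k _]; first exact: finite_finset.
  rewrite -[X in measurable X]setTI; apply: (measurable_interarrival N_poisson) => //.
apply: (@lt_le_trans _ _ (P (\bigcap_(k : 'I_m) (interarrival T k @^-1` A k)))); last first.
  rewrite le_measure ?inE//; apply: measurable_sigma_counting.
  exact: sigma_counting_on_schedule.
rewrite (interarrival_indep N_poisson)//.
elim/big_ind: _ => //; first exact: mule_gt0.
move=> k _; rewrite (interarrival_law N_poisson)// exponential_prob_itv_gt0//.
  by rewrite subr_gt0.
by rewrite ltrDl.
Qed.

End jump_times_near_schedule.

(** * Robust transitions and events of positive probability *)

Section jump_probabilities.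
Context {R : realType} {d : nat} {E : finType}.
Context (M : set 'rV[R]_d).
Hypothesis M_compact : compact M.
Context (rate : 'rV[R]_d -> E -> E -> R).
Hypothesis rate_continuous : forall i j, {within M, continuous (fun x => rate x i j)}.
Hypothesis rate_ge0 : forall x i j, M x -> i != j -> 0 <= rate x i j.
Hypothesis rate_diag : forall x i, M x -> rate x i i = 0.
Hypothesis rate_irreducible : forall x, M x -> irreducible (rate x).
Context (lam : R).
Hypothesis lam_gt : forall x i, M x -> \sum_(j | j != i) rate x i j < lam.

Lemma lam_gt0 x (i : E) : M x -> 0 < lam.
Proof.
move=> Mx; apply: le_lt_trans (lam_gt i Mx); apply: sumr_ge0 => j ji.
by apply: rate_ge0 => //; rewrite eq_sym.
Qed.

Lemma jump_prob_stay_gt0 x i : M x -> 0 < jump_prob rate lam x i i.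
Proof.
move=> Mx; rewrite /jump_prob eqxx -mulr_suml subr_gt0 ltr_pdivrMr ?mul1r.
  exact: lam_gt.
exact: (lam_gt0 i Mx).
Qed.

Lemma jump_prob_gt0 x i j : M x -> 0 < rate x i j -> 0 < jump_prob rate lam x i j.
Proof.
move=> Mx rij; rewrite /jump_prob; case: eqP => ij.
  by move: rij; rewrite ij rate_diag// ltxx.
by rewrite divr_gt0//; exact: (lam_gt0 i Mx).
Qed.

(** Positivity is required on a whole ball, since the position at which a jump occurs is known only
    approximately. [jump_prob] is used instead of [rate], so that loops are edges. *)
Definition robust_edge (r : R) (y : 'rV[R]_d) : rel E :=
  [rel k l | `[< forall z, M z -> `|z - y| < r -> 0 < jump_prob rate lam z k l >]].

Lemma rate_near_gt0 x i j : M x -> 0 < rate x i j ->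
  \forall z \near x, M z -> 0 < rate z i j.
Proof.
move=> Mx rij.
have o0 : open (`]0, +oo[%classic : set R) by exact: rray_open.
have /continuousP/(_ _ o0)/open_subspaceP[V oV VM] := @rate_continuous i j.
have Vx : V x.
  have [] // : (V `&` M) x.
  by rewrite VM; split => //; rewrite /from_subspace/= in_itv/= andbT.
have : nbhs x V by exact: open_nbhs_nbhs.
apply: filterS => z Vz Mz.
have [] : ((from_subspace M (fun x => rate x i j)) @^-1` `]0, +oo[%classic `&` M) z.
  by rewrite -VM; split.
by rewrite /from_subspace/= in_itv/= andbT.
Qed.

(** By continuity the finitely many positive rates at x remain positive near x, so for y near x and
    r small the robust graph at y contains the irreducible graph of [rate x]. Compactness of M makes
    r uniform. *)
Lemma uniform_robust_connect : exists2 r0, 0 < r0 &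
  forall y, M y -> forall i j, connect (robust_edge r0 y) i j.
Proof.
have : \forall r \near 0^'+, M `<=` [set y | forall i j, connect (robust_edge r y) i j].
  move/compact_near_coveringP: M_compact; apply => x Mx.
  have : \forall z \near x, forall p : E * E, M z -> 0 < rate x p.1 p.2 -> 0 < rate z p.1 p.2.
    apply: (@filter_forall _ _ (fun (p : E * E) z => M z -> 0 < rate x p.1 p.2 ->
      0 < rate z p.1 p.2) (nbhs x)) => -[i j] /=.
    have [rij|rij] := boolP (0 < rate x i j); last by near=> z => _ //.
    by apply: filterS (rate_near_gt0 Mx rij) => z h /h.
  move=> /nbhs_ballP[e /= e0 xe].
  have e20 : 0 < e / 2 by rewrite divr_gt0.
  near=> y r.
  have xy : `|x - y| < e / 2 by near: y; apply: cvgr_dist_lt => //.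
  have re : r < e / 2 by near: r; exact: nbhs_right_lt.
  move=> i j; apply: connect_sub (rate_irreducible Mx i j) => k l /= rkl.
  apply: connect1; apply/asboolP => z Mz zy; apply: jump_prob_gt0 => //.
  apply: (xe z _ (k, l)) => //; rewrite -ball_normE /ball_/=.
  have := ler_normD (x - y) (y - z); rewrite addrA subrK (distrC y); lra.
move=> h; near (0 : R)^'+ => r; exists r; first by near: r; exact: nbhs_right_gt.
by near: r; exact: h.
Unshelve. all: by end_near. Qed.

Context (disp : measure_display) (Omega : measurableType disp).

(** The preimage of an open ray under g is known only as the trace on M of an open set V; as X takes
    its values in M, pulling back V gives the same event. *)
Lemma measurable_within_comp (g : 'rV[R]_d -> R) (X : Omega -> 'rV[R]_d) :
  {within M, continuous g} -> (forall w, M (X w)) ->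
  (forall A, open A -> measurable (X @^-1` A)) ->
  measurable_fun setT (g \o X).
Proof.
move=> cg MX mX; apply: (measurability _ (RGenOInfty.measurableE R)) => //.
move=> _ [_ [a ->] <-]; rewrite setTI.
have oa : open (`]a, +oo[%classic : set R) by exact: rray_open.
move/continuousP: cg => /(_ _ oa) /open_subspaceP[V oV VM].
have -> : (g \o X) @^-1` `]a, +oo[%classic = X @^-1` V.
  apply/seteqP; split=> w h.
    have [] // : (V `&` M) (X w).
    by rewrite VM; split.
  have [] // : ((from_subspace M g) @^-1` `]a, +oo[%classic `&` M) (X w).
  by rewrite -VM; split.
exact: mX.
Qed.

Lemma measurable_jump_prob (X : Omega -> 'rV[R]_d) i j :
  (forall w, M (X w)) -> (forall A, open A -> measurable (X @^-1` A)) ->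
  measurable_fun setT (fun w => jump_prob rate lam (X w) i j).
Proof.
move=> MX mX; rewrite /jump_prob.
have mr k l : measurable_fun setT (fun w => rate (X w) k l / lam).
  apply: measurable_funM; last exact: measurable_cst.
  exact: (@measurable_within_comp (fun x => rate x k l)).
case: (i == j); last exact: mr.
apply: measurable_funB; first exact: measurable_cst.
rewrite (_ : (fun w => _) = (fun w => \sum_k (if k != i then rate (X w) i k / lam else 0))).
  by apply: measurable_sum => k; case: (k != i); [exact: mr|exact: measurable_cst].
by apply/funext => w; rewrite big_mkcond.
Qed.

Context (P : probability Omega R) (Phi : E -> R -> 'rV[R]_d -> 'rV[R]_d).
Context (N : time R -> Omega -> nat) (T : nat -> Omega -> R).
Hypothesis N_poisson : poisson_process P lam N T.
Hypothesis M_invariant : forall i t x, 0 <= t -> M x -> M (Phi i t x).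
Context (Zt : nat -> Omega -> 'rV[R]_d * E).
Hypothesis Zt_chain : embedded_chain P Phi M (jump_prob rate lam) N T Zt.

Lemma integral_pos_gt0 (f : Omega -> R) (B : set Omega) :
  measurable B -> measurable_fun setT f -> (forall w, B w -> 0 < f w) ->
  (0 < P B)%E -> (0 < \int[P]_(w in B) (f w)%:E)%E.
Proof.
move=> mB mf f0 PB.
have mf' : measurable_fun B (fun w => (f w)%:E).
  by apply/measurable_EFinP; exact: measurable_funTS.
have fabs : (\int[P]_(w in B) (f w)%:E = \int[P]_(w in B) `|(f w)%:E|)%E.
  by apply: eq_integral => w /set_mem Bw; rewrite gee0_abs// lee_fin ltW// f0.
rewrite lt_neqAle integral_ge0 ?andbT; last first.
  by move=> w Bw; rewrite lee_fin ltW// f0.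
apply/eqP => /esym; rewrite fabs => /(ae_eq_integral_abs P mB mf')[A [mA A0 BA]].
have BsubA : B `<=` A.
  move=> w Bw; apply: BA => /= /(_ Bw) /= [fw].
  by have := f0 w Bw; rewrite fw ltxx.
have : (P B <= P A)%E by rewrite le_measure ?inE.
by rewrite A0 leNgt PB.
Qed.

Lemma null_bigsetU (I : eqType) (s : seq I) (A : I -> set Omega) :
  (forall i, i \in s -> measurable (A i)) -> (forall i, i \in s -> P (A i) = 0%E) ->
  measurable (\big[setU/set0]_(i <- s) A i) /\ P (\big[setU/set0]_(i <- s) A i) = 0%E.
Proof.
move=> mA A0; rewrite big_seq; elim/big_ind: _ => [|B B' [mB B0] [mB' B'0]|i si].
- by split; [exact: measurable0|exact: measure0].
- split; first exact: measurableU.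
  apply/eqP; rewrite eq_le measure_ge0 andbT.
  rewrite (le_trans (measureU2 _ mB mB'))//.
  by rewrite [X in (X + _)%E]B0 [X in (_ + X)%E]B'0 adde0.
- by split; [exact: mA|exact: A0].
Qed.

(** The invariant of the construction: [embedded_law] applies at index n to such an event, which can
    thus be refined jump after jump. *)
Definition likely n (B : set Omega) := sigma_past N Zt n B /\ (0 < P B)%E.

Lemma sigma_past_chain n k A : (k <= n)%N -> state_measurable A ->
  sigma_past N Zt n (Zt k @^-1` A).
Proof.
move=> kn mA; apply: sub_sigma_algebra; left; exists k => //.
by exists A => //; rewrite setTI.
Qed.

Lemma sigma_past_counting n A : sigma_counting N A -> sigma_past N Zt n A.
Proof. by move=> cA; apply: sub_sigma_algebra; right. Qed.

Lemma sigma_pastS n A : sigma_past N Zt n A -> sigma_past N Zt n.+1 A.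
Proof.
apply: sub_sigma_algebra2 => B [[k kn h]|h]; last by right.
by left; exists k => //; exact: leqW.
Qed.

Lemma measurable_sigma_past n A : sigma_past N Zt n A -> measurable A.
Proof.
apply: smallest_sub; first exact: sigma_algebra_measurable.
move=> B [[k _ [A' mA' <-]]|]; last exact: (measurable_sigma_counting N_poisson).
by rewrite setTI; exact: (embedded_measurable Zt_chain).
Qed.

Lemma state_measurable_position (A : set 'rV[R]_d) : open A ->
  @state_measurable R d E [set z | A z.1].
Proof. by move=> oA i; exact: sub_sigma_algebra. Qed.

Lemma state_measurable_mode i : @state_measurable R d E [set z | z.2 = i].
Proof.
have := @state_measurable_open R d E setT i openT.
by rewrite (_ : [set _ | _] = [set z | z.2 = i])//; apply/seteqP; split => z //= [].
Qed.

(** The probability of the refined event is the integral over B of a positive function. The position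
    at index n + 1 is determined by the n-th state and the interarrival time, so it can be
    controlled on B before the new mode is chosen. *)
Lemma likely_jump n i j B : likely n B -> (forall w, B w -> (Zt n w).2 = i) ->
  (forall w, B w -> 0 < jump_prob rate lam (Zt n.+1 w).1 i j) ->
  likely n.+1 (B `&` [set w | (Zt n.+1 w).2 = j]).
Proof.
move=> [sB PB] Bi Bj; split.
  refine (gsigmaI (sigma_pastS sB) _).
  exact: (sigma_past_chain (leqnn _) (state_measurable_mode j)).
have BE : B `&` [set w | (Zt n w).2 = i] = B.
  by apply/seteqP; split => [w []//|w Bw]; split => //; exact: Bi.
have := embedded_law Zt_chain i j sB; rewrite BE => ->.
apply: integral_pos_gt0 => //; first exact: measurable_sigma_past sB.
apply: (@measurable_jump_prob (fun w => (Zt n.+1 w).1)).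
  move=> w; exact: (chain_in_M M_invariant N_poisson Zt_chain).
by move=> A /state_measurable_position/(embedded_measurable Zt_chain n.+1).
Qed.

Lemma likely_path n i p B : likely n B -> (forall w, B w -> (Zt n w).2 = i) ->
  (forall k j l, (k < size p)%N -> nth i (i :: p) k = j -> nth i (i :: p) k.+1 = l ->
    forall w, B w -> 0 < jump_prob rate lam (Zt (n + k).+1 w).1 j l) ->
  exists B', [/\ likely (n + size p) B', B' `<=` B &
    forall w, B' w -> (Zt (n + size p) w).2 = last i p].
Proof.
elim: p n i B => [|l p ih] n i B gB Bi Bp.
  by exists B; rewrite addn0; split.
have gB1 := @likely_jump n i l B gB Bi _.
have [|||B' [gB' B'B B'l]] := ih n.+1 l (B `&` [set w | (Zt n.+1 w).2 = l]).
- apply: gB1 => w Bw; have := @Bp 0%N i l (ltn0Sn _) erefl erefl w Bw.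
  by rewrite addn0.
- by move=> w [].
- move=> k j l' kp kj kl w [Bw _]; rewrite addSnnS.
  apply: (@Bp k.+1 j l') => //=.
    by rewrite -kj; apply: set_nth_default => //=; rewrite ltnS ltnW.
  by rewrite -kl/=; exact: set_nth_default.
exists B'; rewrite /= addnS -addSn; split => //.
by apply: subset_trans B'B _ => w [].
Qed.

(** Finitely many balls of radius rho cover M; if B met each of them in a null event, B itself would
    be null. *)
Lemma likely_localize n B (rho : R) : likely n B -> 0 < rho ->
  exists2 y, M y & likely n (B `&` [set w | `|(Zt n w).1 - y| < rho]).
Proof.
move=> [sB PB] rho0; apply: contrapT => noy.
have small y : M y -> P (B `&` [set w | `|(Zt n w).1 - y| < rho]) = 0%E.
  move=> My; apply/eqP; apply/negPn/negP => h; apply: noy; exists y => //; split.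
    refine (gsigmaI sB _).
    apply: (@sigma_past_chain n n [set z | `|z.1 - y| < rho]) => //.
    apply: (@state_measurable_position [set x | `|x - y| < rho]).
    exact: open_dist_lt.
  by rewrite lt_neqAle eq_sym h measure_ge0.
have mB := measurable_sigma_past sB.
move: M_compact; rewrite compact_cover => /(_ _ M (fun y => [set x | `|x - y| < rho])).
case.
- by move=> y _; exact: open_dist_lt.
- by move=> y My; exists y => //=; rewrite subrr normr0.
move=> D DM Mcov.
pose s := finmap.enum_fset D.
have sM y : y \in s -> M y by move=> yD; have /set_mem := DM y yD.
have mBy y : measurable (B `&` [set w | `|(Zt n w).1 - y| < rho]).
  apply: measurableI => //.
  have := @state_measurable_position [set x | `|x - y| < rho] (@open_dist_lt R d y rho).
  exact: (embedded_measurable Zt_chain n).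
have BE : B = \bigcup_(y in [set` s]) (B `&` [set w | `|(Zt n w).1 - y| < rho]).
  apply/seteqP; split=> w; last by move=> [y _ []].
  move=> Bw; have [y yD h] := Mcov _ (chain_in_M M_invariant N_poisson Zt_chain n w).
  by exists y.
have [|_] := @null_bigsetU _ s
  (fun y => B `&` [set w | `|(Zt n w).1 - y| < rho]) (fun y _ => mBy y).
  by move=> y ys; apply: small; exact: sM.
by rewrite -bigcup_seq -BE => B0; rewrite B0 ltxx in PB.
Qed.

End jump_probabilities.

(** * Pursuit of a solution *)

Section dot_product.
Context {R : realType} {d : nat}.
Implicit Types u v w : 'rV[R]_d.

(** The norm of row vectors is the maximum norm, whereas pursuit expands a Euclidean squared
    distance. The comparison of the two is the source of the factors d in the constants. *)
Definition dot u v : R := \sum_j u 0 j * v 0 j.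

Lemma dotC u v : dot u v = dot v u.
Proof. by apply: eq_bigr => j _; rewrite mulrC. Qed.

Lemma dotDl u v w : dot (u + v) w = dot u w + dot v w.
Proof. by rewrite -big_split/=; apply: eq_bigr => j _; rewrite mxE mulrDl. Qed.

Lemma dotDr u v w : dot u (v + w) = dot u v + dot u w.
Proof. by rewrite dotC dotDl !(dotC _ u). Qed.

Lemma dotZl (a : R) u v : dot (a *: u) v = a * dot u v.
Proof. by rewrite /dot mulr_sumr; apply: eq_bigr => j _; rewrite mxE mulrA. Qed.

Lemma dotZr (a : R) u v : dot u (a *: v) = a * dot u v.
Proof. by rewrite dotC dotZl dotC. Qed.

Lemma dotBr u v w : dot u (v - w) = dot u v - dot u w.
Proof. by rewrite -scaleN1r dotDr dotZr mulN1r. Qed.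

Lemma dot0r u : dot u 0 = 0.
Proof. by rewrite /dot big1// => j _; rewrite mxE mulr0. Qed.

Lemma dot_sumr (I : finType) u (v : I -> 'rV[R]_d) :
  dot u (\sum_i v i) = \sum_i dot u (v i).
Proof. by apply: (big_morph (dot u)); [exact: dotDr|exact: dot0r]. Qed.

Lemma dot_norm_le u v : `|dot u v| <= d%:R * (`|u| * `|v|).
Proof.
rewrite (le_trans (ler_norm_sum _ _ _))//.
rewrite (@le_trans _ _ (\sum_(j < d) `|u| * `|v|))//.
  by apply: ler_sum => j _; rewrite normrM ler_pM// coord_norm_le.
by rewrite sumr_const card_ord mulr_natl.
Qed.

Lemma norm_sqr_le_dot u : `|u| ^+ 2 <= dot u u.
Proof.
have d0 : 0 <= dot u u by apply: sumr_ge0 => j _; rewrite -expr2 sqr_ge0.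
rewrite -(sqr_sqrtr d0) lerXn2r ?nnegrE ?sqrtr_ge0//.
apply: norm_le_coord => [|j]; first exact: sqrtr_ge0.
rewrite -sqrtr_sqr ler_wsqrtr// /dot (bigD1 j)//= -expr2 lerDl.
by apply: sumr_ge0 => k _; rewrite -expr2 sqr_ge0.
Qed.

(** A minimum is at most any weighted mean. *)
Lemma exists_dot_le {E : finType} (i0 : E) (a : E -> R) u (v : E -> 'rV[R]_d) :
  weights a -> exists i, dot u (v i) <= dot u (\sum_j a j *: v j).
Proof.
move=> [a0 a1].
case: (@arg_minP _ _ E i0 xpredT (fun i => dot u (v i))) => // i _ imin.
exists i; rewrite dot_sumr -[leLHS]mul1r -a1 mulr_suml.
by apply: ler_sum => j _; rewrite dotZr ler_wpM2l// imin.
Qed.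

End dot_product.

Section pursuit.
Context {R : realType} {d : nat} {E : finType}.
Context (F : E -> 'rV[R]_d -> 'rV[R]_d) (C : R).
Hypothesis C_ge0 : 0 <= C.
Hypothesis F_le : forall i x, `|F i x| <= C.
Context (Phi : E -> R -> 'rV[R]_d -> 'rV[R]_d).
Hypothesis F_flow : forall i, is_flow (F i) (Phi i).
Context (r K L : R).
Hypothesis K_ge0 : 0 <= K.
Hypothesis L_ge0 : 0 <= L.
Hypothesis F_lip : forall i x y, `|x| <= r -> `|y| <= r ->
  `|F i x - F i y| <= K * `|x - y|.

(** Bound, in units of h^2, for the defect [q] of [pursuit_step]: 2 C for the motion during the
    short steps and the error on the duration U, 4 K C for the Taylor remainder with U <= 2 h, K (C
    + 1) for evaluating the field at y instead of X1, and L for the target. *)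
Definition pursuit_defect : R := 2 * C + 4 * (K * C) + K * (C + 1) + L.

(** The terms come from expanding the square of e + h g + q in [pursuit_step]: 4 K and 4 C from the
    product of e and h g, 4 r times the defect from that of e and q, the last one from the square of
    h g + q. *)
Definition pursuit_error : R :=
  d%:R * (4 * K + 4 * C + 4 * (r * pursuit_defect) + (2 * C + pursuit_defect) ^+ 2).

Lemma pursuit_defect_ge0 : 0 <= pursuit_defect.
Proof. by rewrite !addr_ge0// !mulr_ge0// addr_ge0. Qed.

Lemma pursuit_error_ge0 : 0 <= r -> 0 <= pursuit_error.
Proof.
move=> r0; have D0 := pursuit_defect_ge0.
by rewrite mulr_ge0// addr_ge0 ?sqr_ge0// !addr_ge0// !mulr_ge0.
Qed.

(* Extremal aiming: following, from a point close to [y], the field which points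
   most toward [p] at [y] keeps the squared distance to the target under control,
   whatever convex combination drives the target from [p] to [p']. *)
Lemma pursuit_step (h U : R) (y X0 X1 p p' : 'rV[R]_d) (a : E -> R) (j : E) :
  0 < h -> h <= 1 -> weights a ->
  `|y| <= r -> `|X0| <= r -> `|X1| <= r -> `|p| <= r ->
  (forall u, 0 <= u <= U -> `|Phi j u X1| <= r) ->
  0 <= U -> `|U - h| <= h ^+ 2 -> `|X1 - X0| <= C * h ^+ 2 -> `|X0 - y| <= h ^+ 2 ->
  `|p' - p - h *: \sum_i a i *: F i p| <= L * h ^+ 2 ->
  dot (y - p) (F j y) <= dot (y - p) (\sum_i a i *: F i y) ->
  dot (Phi j U X1 - p') (Phi j U X1 - p') <=
    (1 + 4 * d%:R * K * h) * dot (X0 - p) (X0 - p) + pursuit_error * h ^+ 2.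
Proof.
move=> h0 h1 wa yr X0r X1r pr PhiU U0 Uh X10 X0y pL aim.
have h20 : 0 <= h ^+ 2 by exact: sqr_ge0.
have h2h : h ^+ 2 <= h by rewrite expr2 ger_pMl.
have h21 : h ^+ 2 <= 1 by exact: le_trans h1.
have r0 : 0 <= r := le_trans (normr_ge0 _) yr.
have D0 := pursuit_defect_ge0.
set Sp := \sum_i a i *: F i p in pL *; set Sy := \sum_i a i *: F i y in aim *.
pose X2 := Phi j U X1.
have X2E : `|X2 - X1 - U *: F j X1| <= K * C * U ^+ 2.
  have := @flow_taylor R d (F j) C (F_le j) (Phi j) (F_flow j) r K K_ge0 (@F_lip j)
    X1 0 U U0 PhiU.
  by rewrite (F_flow j).1 subr0.
have U2h : U <= 2 * h.
  by move: Uh; rewrite ler_norml => /andP[_ Uh]; lra.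
have U2 : U ^+ 2 <= 4 * h ^+ 2.
  have : U ^+ 2 <= (2 * h) ^+ 2 by rewrite lerXn2r ?nnegrE// mulr_ge0// ltW.
  by rewrite exprMn -natrX.
(* The new difference is e + h g + q, where g compares the followed field at y with the velocity of
   the target. The aim concerns e0, which differs from e by at most h^2. *)
pose e := X0 - p; pose e0 := y - p; pose g := F j y - Sp.
pose q := X2 - p' - e - h *: g.
have qE : `|q| <= pursuit_defect * h ^+ 2.
  have -> : q = (X1 - X0) + (X2 - X1 - U *: F j X1) + (U - h) *: F j X1
      + h *: (F j X1 - F j y) - (p' - p - h *: Sp).
    by rewrite /q /e /g; apply/rowP => k; rewrite !mxE; ring.
  have X1y : `|X1 - y| <= (C + 1) * h ^+ 2.
    rewrite -(subrK X0 X1) -addrA (le_trans (ler_normD _ _))// mulrDl mul1r.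
    exact: lerD.
  have n1 := ler_normB ((X1 - X0) + (X2 - X1 - U *: F j X1) + (U - h) *: F j X1
      + h *: (F j X1 - F j y)) (p' - p - h *: Sp).
  have n2 := ler_normD ((X1 - X0) + (X2 - X1 - U *: F j X1) + (U - h) *: F j X1)
      (h *: (F j X1 - F j y)).
  have n3 := ler_normD ((X1 - X0) + (X2 - X1 - U *: F j X1)) ((U - h) *: F j X1).
  have n4 := ler_normD (X1 - X0) (X2 - X1 - U *: F j X1).
  have m1 : `|(U - h) *: F j X1| <= h ^+ 2 * C by rewrite normrZ ler_pM.
  have m2 : `|h *: (F j X1 - F j y)| <= K * (C + 1) * h ^+ 2.
    rewrite normrZ (gtr0_norm h0) (le_trans (ler_wpM2l (ltW h0) (F_lip j X1r yr)))//.
    have : K * `|X1 - y| <= K * ((C + 1) * h ^+ 2) by rewrite ler_wpM2l.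
    have : h * (K * `|X1 - y|) <= K * `|X1 - y|.
      by rewrite ler_piMl// mulr_ge0.
    rewrite mulrA; lra.
  have m3 : K * C * U ^+ 2 <= 4 * (K * C) * h ^+ 2.
    rewrite (le_trans (ler_wpM2l _ U2)) ?mulr_ge0//; lra.
  rewrite /pursuit_defect; lra.
have X2p : X2 - p' = e + (h *: g + q).
  by rewrite /q; apply/rowP => k; rewrite !mxE; ring.
have d0 : 0 <= d%:R :> R by [].
have gC : `|g| <= 2 * C.
  rewrite (le_trans (ler_normB _ _))// mulr_natl mulr2n lerD//.
  exact: norm_weighted_le.
have er : `|e| <= 2 * r by rewrite (le_trans (ler_normB _ _))// mulr_natl mulr2n lerD.
have ee0 : `|e - e0| <= h ^+ 2.
  by rewrite /e /e0 opprB addrA subrK.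
have D1 : dot (e - e0) g <= d%:R * (2 * C) * h ^+ 2.
  rewrite (le_trans (ler_norm _))// (le_trans (dot_norm_le _ _))// -mulrA ler_wpM2l//.
  by rewrite mulrC ler_pM.
(* The aim removes the contribution of F_j(y) - Sy; what remains, Sy - Sp, has the same weights at y
   and at p, hence norm at most K |e0|. *)
have D2 : dot e0 g <= d%:R * K * (2 * dot e e + 2 * h ^+ 2).
  have -> : g = (F j y - Sy) + (Sy - Sp) by rewrite /g addrA subrK.
  rewrite dotDr.
  have : dot e0 (F j y - Sy) <= 0 by rewrite dotBr subr_le0.
  have : dot e0 (Sy - Sp) <= d%:R * K * `|e0| ^+ 2.
    rewrite (le_trans (ler_norm _))// (le_trans (dot_norm_le _ _))// -mulrA ler_wpM2l//.
    have : `|Sy - Sp| <= K * `|e0| by apply: weighted_dist_le => // i; exact: F_lip.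
    move=> /(ler_wpM2l (normr_ge0 e0)); rewrite mulrCA expr2; exact.
  have : `|e0| ^+ 2 <= 2 * dot e e + 2 * h ^+ 2.
    have e0e : `|e0| <= `|e| + h ^+ 2.
      by rewrite -(subKr e e0) (le_trans (ler_normB _ _))// lerD2l.
    have : `|e0| ^+ 2 <= (`|e| + h ^+ 2) ^+ 2.
      by rewrite lerXn2r ?nnegrE// addr_ge0.
    have := norm_sqr_le_dot e; have := sqr_ge0 (`|e| - h ^+ 2).
    have : h ^+ 2 * h ^+ 2 <= h ^+ 2 by rewrite ger_pMl// ?exprn_gt0.
    move: (h ^+ 2) => hh; rewrite !expr2; nra.
  move=> /(ler_wpM2l (mulr_ge0 d0 K_ge0)); lra.
have D3 : dot e q <= d%:R * (2 * (r * pursuit_defect)) * h ^+ 2.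
  rewrite (le_trans (ler_norm _))// (le_trans (dot_norm_le _ _))// -mulrA ler_wpM2l//.
  have : `|e| * `|q| <= (2 * r) * (pursuit_defect * h ^+ 2) by rewrite ler_pM.
  lra.
have D4 : dot (h *: g + q) (h *: g + q) <= d%:R * (2 * C + pursuit_defect) ^+ 2 * h ^+ 2.
  rewrite (le_trans (ler_norm _))// (le_trans (dot_norm_le _ _))// -mulrA ler_wpM2l//.
  have : `|h *: g + q| <= (2 * C + pursuit_defect) * h.
    rewrite (le_trans (ler_normD _ _))// normrZ (gtr0_norm h0) mulrDl lerD//.
      by rewrite mulrC ler_wpM2r// ltW.
    by rewrite (le_trans qE)// ler_wpM2l.
  by move=> le1; rewrite -exprMn expr2 ler_pM.
have -> : dot (Phi j U X1 - p') (Phi j U X1 - p') =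
    dot e e + 2 * (h * dot e g + dot e q) + dot (h *: g + q) (h *: g + q).
  rewrite -/X2 X2p -dotZr -dotDr dotDl !(dotDr _ e) (dotC _ e); ring.
have -> : dot e g = dot e0 g + dot (e - e0) g by rewrite -dotDl addrC subrK.
have D12 : h * (dot e0 g + dot (e - e0) g) <=
    h * (d%:R * K * (2 * dot e e + 2 * h ^+ 2) + d%:R * (2 * C) * h ^+ 2).
  by rewrite ler_wpM2l ?(ltW h0)// lerD.
have dK : 0 <= d%:R * K * 2 * h ^+ 2 + d%:R * (2 * C) * h ^+ 2.
  by apply: addr_ge0; do 4 ?apply: mulr_ge0 => //.
have := ler_wpM2r dK h1; rewrite mul1r => D13.
rewrite /pursuit_error; lra.
Qed.

End pursuit.

Section schedule.
Context {R : realType} (c : nat) (h tau : R).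
Hypothesis tau_gt0 : 0 < tau.
Hypothesis tau_lt : c%:R * tau < h.

(* The times of [c] short steps followed by a long one, repeated with period [h]. *)
Definition schedule (n : nat) : R := (n %/ c.+1)%:R * h + (n %% c.+1)%:R * tau.

Lemma schedule_step k l : (l <= c)%N -> schedule (k * c.+1 + l) = k%:R * h + l%:R * tau.
Proof. by move=> lc; rewrite /schedule divnMDl// modnMDl divn_small// addn0 modn_small. Qed.

Lemma schedule_period k : schedule (k * c.+1) = k%:R * h.
Proof. by rewrite -[(k * _)%N]addn0 schedule_step// mul0r addr0. Qed.

Lemma schedule0 : schedule 0 = 0.
Proof. by rewrite -(mul0n c.+1) schedule_period mul0r. Qed.

Lemma schedule_increasing n : schedule n < schedule n.+1.
Proof.
rewrite (divn_eq n c.+1); move: (n %/ c.+1)%N => k.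
have : (n %% c.+1 <= c)%N by rewrite -ltnS ltn_mod.
move: (n %% c.+1)%N => l; rewrite leq_eqVlt => /predU1P[->|lc].
  rewrite -addnS -mulSnr schedule_period schedule_step// -natr1 mulrDl mul1r.
  by rewrite ltrD2l.
rewrite -addnS !schedule_step ?(ltnW lc)// ltrD2l -natr1 mulrDl mul1r ltrDl.
exact: tau_gt0.
Qed.

End schedule.

Lemma state_measurable_point {R : realType} {d : nat} {E : finType} (x : 'rV[R]_d) (i : E) :
  state_measurable [set z : 'rV[R]_d * E | z.1 = x /\ z.2 = i].
Proof.
apply: (@state_measurable_rect R d E [set x]).
rewrite -[X in _ X]setCK; refine (gsigmaC _); apply: sub_sigma_algebra.
apply: closed_openC; apply: compact_closed; first exact: norm_hausdorff.
exact: compact_set1.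
Qed.

(** * Following a solution with positive probability *)

Section following.
Context {R : realType} {d : nat} {E : finType}.
Context (F : E -> 'rV[R]_d -> 'rV[R]_d) (Phi : E -> R -> 'rV[R]_d -> 'rV[R]_d).
Context (C : R).
Hypothesis C_ge0 : 0 <= C.
Hypothesis F_le : forall i x, `|F i x| <= C.
Hypothesis F_smooth : forall i, smooth (F i).
Hypothesis F_bounded : forall i, bounded_fun (F i).
Hypothesis F_flow : forall i, is_flow (F i) (Phi i).
Context (M : set 'rV[R]_d).
Hypothesis M_compact : compact M.
Hypothesis M_invariant : forall i t x, 0 <= t -> M x -> M (Phi i t x).
Context (rate : 'rV[R]_d -> E -> E -> R).
Hypothesis rate_continuous : forall i j, {within M, continuous (fun x => rate x i j)}.
Hypothesis rate_ge0 : forall x i j, M x -> i != j -> 0 <= rate x i j.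
Hypothesis rate_diag : forall x i, M x -> rate x i i = 0.
Hypothesis rate_irreducible : forall x, M x -> irreducible (rate x).
Context (lam : R).
Hypothesis lam_gt : forall x i, M x -> \sum_(j | j != i) rate x i j < lam.
Context (disp : measure_display) (Omega : measurableType disp).
Context (P : probability Omega R).
Context (N : time R -> Omega -> nat) (T : nat -> Omega -> R).
Hypothesis N_poisson : poisson_process P lam N T.
Context (Zt : nat -> Omega -> 'rV[R]_d * E).
Hypothesis Zt_chain : embedded_chain P Phi M (jump_prob rate lam) N T Zt.
Context (Z : time R -> Omega -> 'rV[R]_d * E).
Hypothesis Z_interpolates : interpolates Phi T Zt Z.

Let path := path_of C_ge0 F_le F_flow N_poisson Zt_chain Z_interpolates.
Let chain_M := chain_in_M M_invariant N_poisson Zt_chain.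
Let chain_near := chain_dist C_ge0 F_le F_flow N_poisson Zt_chain Z_interpolates.
Local Notation position n w := (Zt n w).1.
Local Notation q := #|E|.+1.

Section macro_step.
Context (r K L : R).
Hypothesis K_ge0 : 0 <= K.
Hypothesis L_ge0 : 0 <= L.
Hypothesis F_lip : forall i x y, `|x| <= r -> `|y| <= r ->
  `|F i x - F i y| <= K * `|x - y|.
Hypothesis M_le : forall x, M x -> `|x| <= r.
Context (r0 : R).
Hypothesis r0_connect : forall y, M y -> forall i j,
  connect (robust_edge M rate lam r0 y) i j.
Context (h tau del : R).
Hypothesis h_gt0 : 0 < h.
Hypothesis h_le1 : h <= 1.
Hypothesis tau_gt0 : 0 < tau.
Hypothesis del_gt0 : 0 < del.
Hypothesis fine_schedule : #|E|%:R * tau + 2 * del <= h ^+ 2.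
Hypothesis h_small : (C + 1) * h ^+ 2 < r0.
Local Notation s := (schedule #|E| h tau).
Local Notation beta := (@pursuit_error R d C r K L).

Lemma macro_step k m i (p p' : 'rV[R]_d) (a : E -> R) (B : set Omega) :
  likely P N Zt (k * q) B -> B `<=` on_schedule T s del m -> (k.+1 * q <= m)%N ->
  (forall w, B w -> (Zt (k * q) w).2 = i) ->
  weights a -> `|p| <= r -> `|p' - p - h *: \sum_i a i *: F i p| <= L * h ^+ 2 ->
  exists B' j, [/\ likely P N Zt (k.+1 * q) B', B' `<=` B,
    forall w, B' w -> (Zt (k.+1 * q) w).2 = j &
    forall w, B' w -> dot (position (k.+1 * q) w - p') (position (k.+1 * q) w - p') <=
      (1 + 4 * d%:R * K * h) * dot (position (k * q) w - p) (position (k * q) w - p)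
        + beta * h ^+ 2].
Proof.
move=> lB Bs km Bi wa pr pL.
have h20 : 0 < h ^+ 2 by rewrite exprn_gt0.
have [y My lB1] := likely_localize M_compact N_poisson M_invariant Zt_chain lB h20.
set B1 := B `&` _ in lB1.
(* The weights are those of the target, so j does at least as well at y as the convex combination
   driving the target. *)
have [j aim] := exists_dot_le i (y - p) (F^~ y) wa.
have er : reflexive (robust_edge M rate lam r0 y).
  move=> l; apply/asboolP => z Mz _.
  exact: (jump_prob_stay_gt0 rate_ge0 lam_gt).
have [pth [epth lpth spth]] := connect_path_card er (r0_connect My i j).
(* The planned gap is at most #|E| tau and both jump times deviate by less than del; [fine_schedule]
   bounds the sum. *)
have near_start w l : B1 w -> (l <= #|E|)%N ->
    `|T (k * q + l) w - T (k * q) w| <= h ^+ 2.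
  move=> [/Bs Dw _] lE.
  have km1 : (k * q + l <= m)%N.
    by apply: leq_trans km; rewrite mulSnr leq_add2l ltnW// ltnS.
  have := Dw _ km1; have := Dw _ (leq_trans (leq_addr l _) km1).
  rewrite schedule_period schedule_step// => d1 d2.
  have lt : l%:R * tau <= #|E|%:R * tau by rewrite ler_pM2r// ler_nat.
  have lt0 : 0 <= l%:R * tau by rewrite mulr_ge0// ltW.
  move: d1 d2; rewrite !ltr_norml ler_norml => /andP[d1 d2] /andP[d3 d4].
  move: d1 d2 d3 d4 lt lt0 fine_schedule del_gt0.
  move: (l%:R * tau) (#|E|%:R * tau) (k%:R * h) (h ^+ 2) => l' E' kh h2.
  by move=> ? ? ? ? ? ? ? ?; apply/andP; split; lra.
have dist_start w l : B1 w -> (l <= #|E|)%N ->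
    `|position (k * q + l) w - position (k * q) w| <= C * h ^+ 2.
  move=> Bw lE; rewrite (le_trans (chain_near _ _ _))// ler_wpM2l//.
  exact: near_start.
have B1y w : B1 w -> `|position (k * q) w - y| <= h ^+ 2 by move=> [_ /ltW].
have last_jump w : B1 w -> `|interarrival T (k * q + #|E|) w - h| <= h ^+ 2.
  move=> [/Bs Dw _].
  have := Dw _ km; have := Dw (k * q + #|E|)%N.
  have -> : (k * q + #|E| <= m)%N by apply: leq_trans km; rewrite mulSnr leq_add2l.
  move=> /(_ isT); rewrite schedule_period schedule_step// => d1 d2.
  have kq : (k.+1 * q)%N = (k * q + #|E|).+1 by rewrite mulSnr addnS.
  rewrite /interarrival -kq.
  have Et : 0 <= #|E|%:R * tau by rewrite mulr_ge0// ltW.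
  move: d1 d2; rewrite -[k.+1%:R]natr1 mulrDl mul1r !ltr_norml ler_norml.
  move=> /andP[d1 d2] /andP[d3 d4].
  move: d1 d2 d3 d4 Et fine_schedule del_gt0.
  move: (#|E|%:R * tau) (k%:R * h) (h ^+ 2) => E' kh h2.
  by move=> ? ? ? ? ? ? ?; apply/andP; split; lra.
have [||B2 [lB2 B21 B2j]] := @likely_path R d E M rate rate_continuous
  lam disp Omega P Phi N T N_poisson M_invariant Zt Zt_chain (k * q) i pth B1 lB1.
- by move=> w [Bw _]; exact: Bi.
- move=> l j1 j2 lp jl1 jl2 w B1w.
  have /(pathP i)/(_ l lp)/asboolP := epth.
  rewrite /= in jl2; rewrite jl1 jl2; apply; first exact: chain_M.
  (* Up to the last short step the position stays within (C + 1) h^2 < r0 of y, where the robust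
     edges have positive probability. *)
  have lE : (l.+1 <= #|E|)%N by rewrite -spth.
  rewrite -addnS; have := dist_start w l.+1 B1w lE; have := B1y w B1w.
  have := ler_normD (position (k * q + l.+1) w - position (k * q) w)
    (position (k * q) w - y).
  rewrite addrA subrK; move: h_small; rewrite mulrDl mul1r; lra.
rewrite spth in lB2 B2j; rewrite lpth in B2j.
have kq : (k.+1 * q)%N = (k * q + #|E|).+1 by rewrite mulSnr addnS.
(* The jump ending the long step keeps the mode j, so that the next period also starts from a mode
   that is constant on the event. *)
have lB3 : likely P N Zt (k * q + #|E|).+1
    (B2 `&` [set w | (Zt (k * q + #|E|).+1 w).2 = j]).
  apply: (likely_jump rate_continuous N_poisson M_invariant Zt_chain lB2 B2j) => w _.
  exact: (jump_prob_stay_gt0 rate_ge0 lam_gt).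
exists (B2 `&` [set w | (Zt (k * q + #|E|).+1 w).2 = j]), j; rewrite kq; split => //.
- by move=> w [/B21[]].
- by move=> w [].
move=> w [B2w _]; have B1w := B21 _ B2w.
rewrite (embedded_flow Zt_chain) (B2j _ B2w).
have U0 := ltW (interarrival_gt0 N_poisson (k * q + #|E|) w).
apply: (@pursuit_step R d E F C C_ge0 F_le Phi F_flow r K L K_ge0 L_ge0 F_lip h
  (interarrival T (k * q + #|E|) w) y (position (k * q) w)
  (position (k * q + #|E|) w) p p' a j) => //.
- exact: M_le.
- exact/M_le/chain_M.
- exact/M_le/chain_M.
- by move=> u /andP[u0 _]; apply/M_le/M_invariant => //; exact: chain_M.
- exact: last_jump.
- exact: dist_start.
- exact: B1y.
Qed.

Context (x : 'rV[R]_d) (f : R -> 'rV[R]_d) (n : nat).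
Hypothesis Mx : M x.
Hypothesis f0 : f 0 = x.
Hypothesis f_le : forall t, 0 <= t -> t <= n%:R * h -> `|f t| <= r.
Hypothesis f_expansion : frozen_expansion F (n%:R * h) L f.
Hypothesis X0 : {ae P, forall w, (Zt 0%N w).1 = x}.

Definition energy_bound (k : nat) : R :=
  iter k (fun e => (1 + 4 * d%:R * K * h) * e + beta * h ^+ 2) 0.

(** The law of the initial mode is arbitrary; as E is finite, some mode must have positive
    probability together with the position x. *)
Lemma initial_mode : exists i,
  (0 < P (Zt 0%N @^-1` [set z | z.1 = x /\ z.2 = i]))%E.
Proof.
apply: contrapT => noi.
pose A i := Zt 0%N @^-1` [set z | z.1 = x /\ z.2 = i].
have mA i : measurable (A i).
  by apply: (embedded_measurable Zt_chain); exact: state_measurable_point.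
have A0 i : P (A i) = 0%E.
  apply/eqP/negPn/negP => h0; apply: noi; exists i.
  by rewrite lt_neqAle eq_sym h0 measure_ge0.
have [Nu [mN N0 XN]] := X0.
have [mU U0] := @null_bigsetU R disp Omega P E (enum E) A (fun i _ => mA i) (fun i _ => A0 i).
have : (P setT <= 0)%E.
  have -> : setT = Nu `|` \big[setU/set0]_(i <- enum E) A i.
    apply/seteqP; split => // w _.
    have [Nw|Nw] := pselect (Nu w); [by left|right].
    rewrite -bigcup_seq; exists (Zt 0%N w).2; first by rewrite /= mem_enum.
    split => //; apply: contrapT => h1; apply: Nw; exact: XN.
  rewrite (le_trans (measureU2 _ mN mU))//.
  by rewrite [X in (X + _)%E]N0 [X in (_ + X)%E]U0 adde0.
by rewrite probability_setT lee_fin ler10.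
Qed.

(** The jump times are constrained up to the final index n q already for k = 0, and later periods
    only restrict the modes and the position. All l <= k are kept in the estimate because the path
    must be close to f throughout. *)
Lemma follow_solution k : (k <= n)%N -> exists B i,
  [/\ likely P N Zt (k * q) B, B `<=` on_schedule T s del (n * q),
    forall w, B w -> (Zt (k * q) w).2 = i &
    forall w l, B w -> (l <= k)%N ->
      dot (position (l * q) w - f (l%:R * h)) (position (l * q) w - f (l%:R * h))
        <= energy_bound l].
Proof.
have Es : #|E|%:R * tau < h.
  have h2 : h ^+ 2 <= h by rewrite expr2 ger_pMl.
  move: h2 fine_schedule del_gt0; move: (#|E|%:R * tau) (h ^+ 2) => E' h2.
  by move=> ? ? ?; lra.
elim: k => [_|k ih kn].
  have [i Pi] := initial_mode.
  have cD : sigma_counting N (on_schedule T s del (n * q)).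
    exact: (sigma_counting_on_schedule N_poisson).
  exists (Zt 0%N @^-1` [set z | z.1 = x /\ z.2 = i] `&` on_schedule T s del (n * q)), i.
  have smA := @state_measurable_point R d E x i.
  split.
  - split.
      refine (gsigmaI _ _); last exact: sigma_past_counting.
      exact: sigma_past_chain.
    rewrite (embedded_init_indep Zt_chain)// mule_gt0//.
    apply: (on_schedule_gt0 (lam_gt0 rate_ge0 lam_gt i Mx) N_poisson) => //.
    + exact: schedule0.
    + by move=> l; exact: schedule_increasing.
  - by move=> w [].
  - by move=> w [[]].
  - move=> w l [[/= wx _] _]; rewrite leqn0 => /eqP ->.
    by rewrite mul0n mul0r f0 wx subrr dot0r.
have [B [i [lB Bs Bi Be]]] := ih (ltnW kn).
have kh0 : 0 <= k%:R * h by rewrite mulr_ge0// ltW.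
have khS : k%:R * h <= k.+1%:R * h by rewrite ler_pM2r// ler_nat.
have kSn : k.+1%:R * h <= n%:R * h by rewrite ler_pM2r// ler_nat.
have [a wa aL] := f_expansion kh0 khS kSn.
have hE : k.+1%:R * h - k%:R * h = h by rewrite -natr1 mulrDl mul1r addrAC subrr add0r.
rewrite hE in aL.
have [|B' [j [lB' B'B B'j B'e]]] := macro_step lB Bs _ Bi wa (f_le kh0 (le_trans khS kSn)) aL.
  by rewrite leq_mul2r kn orbT.
exists B', j; split => //; first exact: subset_trans B'B Bs.
move=> w l B'w; rewrite leq_eqVlt => /predU1P[->|]; last first.
  by rewrite ltnS; apply: Be; exact: B'B.
rewrite (le_trans (B'e _ B'w))// /energy_bound iterS lerD2r ler_wpM2l//.
  by rewrite addr_ge0// !mulr_ge0// ltW.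
by apply: Be => //; exact: B'B.
Qed.

Lemma energy_bound_le k : 0 <= r ->
  energy_bound k <= expR (4 * d%:R * K * h * k%:R) * (k%:R * (beta * h ^+ 2)).
Proof.
move=> r_ge0.
have := @discrete_gronwall R (4 * d%:R * K * h) (beta * h ^+ 2) energy_bound k.
rewrite {3}/energy_bound/= add0r; apply => //.
- by rewrite !mulr_ge0// ltW.
- by rewrite mulr_ge0 ?sqr_ge0// pursuit_error_ge0.
Qed.

End macro_step.

Lemma solution_in_support (i0 : E) (x : 'rV[R]_d) (eta : cpath R d) (A : set (cpath R d)) :
  M x -> {ae P, forall w, (Zt 0%N w).1 = x} ->
  inclusion_solutions F x eta -> open A -> A eta -> (0 < P (path @^-1` A))%E.
Proof.
move=> Mx X0 /inclusion_solutionsP[sf fx] oA Aeta.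
have [b0 [e [e0 tA]]] := tube_basis (open_nbhs_nbhs (conj oA Aeta)).
pose f := extend_path eta; have f0 : f 0 = x by rewrite /f extend_path0.
pose b := `|b0| + 1; have b_gt0 : 0 < b by rewrite ltr_pwDr.
have [r1 r1_ge0 Mr1] : exists2 r1 : R, 0 <= r1 & forall y, M y -> `|y| <= r1.
  have [r1 [_ Mr1]] := compact_bounded M_compact.
  exists (`|r1| + 1) => [|y My]; first by rewrite addr_ge0.
  by apply: (Mr1 (`|r1| + 1)) => //; rewrite ltr_pwDr// ler_norm.
(* The ball of radius r contains M and the solution up to time b. *)
pose r := r1 + C * b.
have Cb_ge0 : 0 <= C * b by rewrite mulr_ge0// ltW.
have r_ge0 : 0 <= r by rewrite addr_ge0.
have M_le y : M y -> `|y| <= r by move=> /Mr1 h; rewrite (le_trans h)// lerDl.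
have [K K_ge0 F_lip] := lipschitz_all_modes F_smooth r.
pose L := K * C + 1; have L_ge0 : 0 <= L by rewrite addr_ge0// mulr_ge0.
have fr : `|f 0| + C * b <= r by rewrite f0 lerD2r Mr1.
have f_expansion := solution_frozen_expansion C_ge0 F_le i0 sf K_ge0 fr F_lip.
have [r0 r0_gt0 r0_connect] := uniform_robust_connect M_compact rate_continuous
  rate_ge0 rate_diag rate_irreducible lam_gt.
pose beta := @pursuit_error R d C r K L.
have beta_ge0 : 0 <= beta by exact: pursuit_error_ge0.
pose c1 := expR (4 * d%:R * K * b) * (beta * b).
have c1_ge0 : 0 <= c1 by rewrite mulr_ge0 ?expR_ge0// mulr_ge0// ltW.
(* Bounds on h, in this order: for [pursuit_step]; to get c1 h <= (e / 4)^2, where c1 h bounds the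
   squared distance at the ends of periods; to get (3 C + 1) h <= e / 4 for the motions within a
   period; to get (C + 1) h^2 < r0. *)
pose eps := Num.min (Num.min 1 ((e / 4) ^+ 2 / (c1 + 1)))
  (Num.min (e / 4 / (3 * C + 1)) (r0 / 2 / (C + 1))).
have c10 : 0 < c1 + 1 by rewrite ltr_pwDr.
have C10 : 0 < C + 1 by rewrite ltr_pwDr.
have C30 : 0 < 3 * C + 1 by rewrite ltr_pwDr// mulr_ge0.
have e4 : 0 < e / 4 by rewrite divr_gt0.
have eps_gt0 : 0 < eps.
  by rewrite !lt_min ltr01 !divr_gt0// exprn_gt0.
pose n := Num.bound (b / eps).
pose h := b / n.+1%:R.
have h_gt0 : 0 < h by rewrite divr_gt0.
have hb : n.+1%:R * h = b by rewrite mulrC divfK// pnatr_eq0.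
have h_eps : h <= eps.
  rewrite ler_pdivrMr// mulrC -ler_pdivrMr//.
  rewrite (le_trans (ltW (archi_boundP _)))//; last by rewrite ler_nat.
  by rewrite divr_ge0// ltW.
move: h_eps; rewrite !le_min -andbA => /and4P[h_le1 h_c1 h_e h_r0].
rewrite ler_pdivlMr// in h_c1; rewrite ler_pdivlMr// in h_e.
rewrite ler_pdivlMr// in h_r0.
have h2_gt0 : 0 < h ^+ 2 by rewrite exprn_gt0.
have h2_le : h ^+ 2 <= h by rewrite expr2 ger_pMl.
pose tau := h ^+ 2 / (4 * #|E|.+1%:R); pose del := h ^+ 2 / 4.
have tau_gt0 : 0 < tau by rewrite divr_gt0// mulr_gt0.
have del_gt0 : 0 < del by rewrite divr_gt0.
have fine : #|E|%:R * tau + 2 * del <= h ^+ 2.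
  have : #|E|%:R * tau <= #|E|.+1%:R * tau by rewrite ler_pM2r// ler_nat.
  have -> : #|E|.+1%:R * tau = h ^+ 2 / 4.
    by rewrite /tau invfM mulrCA (mulrC _ #|E|.+1%:R^-1) mulVKf// pnatr_eq0.
  by rewrite /del; move: (_ * tau) (h ^+ 2) h2_gt0 => z1 z2 z2_gt0 ?; lra.
have h_small : (C + 1) * h ^+ 2 < r0.
  have : (C + 1) * h ^+ 2 <= (C + 1) * h by rewrite ler_wpM2l// ltW.
  by rewrite (mulrC _ h) => /le_lt_trans; apply; lra.
have f_le t : 0 <= t -> t <= n.+1%:R * h -> `|f t| <= r.
  rewrite hb => t0 tb; have := solution_lipschitz C_ge0 F_le sf (lexx 0) t0.
  rewrite -/f f0 subr0 => h1; rewrite -(subrK x (f t)) (le_trans (ler_normD _ _))//.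
  rewrite addrC lerD ?Mr1// (le_trans h1)// ler_wpM2l//.
have fexp : frozen_expansion F (n.+1%:R * h) L f by rewrite hb.
have [B [i [[sB PB] Bs _ Be]]] := follow_solution K_ge0 L_ge0 F_lip M_le r0_connect h_gt0 h_le1
  tau_gt0 del_gt0 fine h_small Mx f0 f_le fexp X0 (leqnn n.+1).
have mB : measurable B.
  exact: (measurable_sigma_past N_poisson Zt_chain sB).
apply: (lt_le_trans PB); apply: le_measure; rewrite ?inE//.
  rewrite -[X in measurable X]setTI.
  apply: (measurable_path_of C_ge0 F_le F_smooth F_bounded F_flow N_poisson Zt_chain
    Z_interpolates) => //.
  exact: sub_sigma_algebra.
move=> w Bw; apply: tA => t tb.
have t0 := time_ge0 t.
have tbb : \val t <= b.
  by rewrite (le_trans tb)// (le_trans (ler_norm _))// lerDl.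
have th0 : 0 <= \val t / h by rewrite divr_ge0// ltW.
pose l := Num.truncn (\val t / h).
have /andP[] := truncn_itv th0.
rewrite -/l ler_pdivlMr// ltr_pdivrMr// => lt tl.
have lh0 : 0 <= l%:R * h by rewrite mulr_ge0// ltW.
have ln : (l <= n.+1)%N.
  by rewrite -(@ler_nat R) -(ler_pM2r h_gt0) hb (le_trans lt).
have := Be w l Bw ln.
have := Bs w Bw (l * #|E|.+1)%N; rewrite leq_mul2r ln orbT => /(_ isT).
rewrite schedule_period; set S := T _ w => Sl.
set v := (Zt _ w).1 => ve.
have vE : extend_path (path w) S = v by exact: path_of_switch.
have vf : `|v - f (l%:R * h)| <= e / 4.
  rewrite -(@ler_pXn2r _ 2)// ?nnegrE ?(ltW e4)//.
  rewrite (le_trans (norm_sqr_le_dot _))// (le_trans ve)//.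
  rewrite (le_trans (energy_bound_le K_ge0 L_ge0 h_gt0 l r_ge0))//.
  rewrite (@le_trans _ _ (c1 * h))//; last first.
    by rewrite (le_trans _ h_c1)// mulrDr mulr1 mulrC lerDl ltW.
  have lhb : l%:R * h <= b by rewrite (le_trans lt).
  rewrite (_ : 4 * d%:R * K * h * l%:R = 4 * d%:R * K * (l%:R * h)); last by ring.
  rewrite /c1 -[leRHS]mulrA ler_pM ?expR_ge0//.
  - by rewrite mulr_ge0// mulr_ge0// ltW.
  - by rewrite ler_expR ler_wpM2l// !mulr_ge0.
  - have -> : l%:R * (beta * h ^+ 2) = beta * (l%:R * h) * h by ring.
    by rewrite ler_wpM2r ?(ltW h_gt0)// ler_wpM2l.
have ff : `|f (\val t) - f (l%:R * h)| <= C * h.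
  rewrite (le_trans (solution_lipschitz C_ge0 F_le sf lh0 lt))// ler_wpM2l//.
  by move: tl; rewrite -natr1 mulrDl mul1r; lra.
(* t lies within h of the planned time l h, and the jump time S within del <= h / 4 of it. *)
have pv : `|path w t - v| <= C * (2 * h).
  rewrite -(extend_pathE (path w)) -vE.
  rewrite (le_trans (path_of_dist _ _ _ _ _ _ _ _ _))// ler_wpM2l//.
  move: Sl tl lt; rewrite -natr1 mulrDl mul1r /del; move: (l%:R * h) (h ^+ 2) h2_le.
  move=> lh h2 h2h; rewrite ltr_norml ler_norml => /andP[S1 S2] tl lt.
  by apply/andP; split; lra.
rewrite -(extend_pathE eta) -/f.
have -> : path w t - f (\val t) = (path w t - v) + (v - f (l%:R * h))
    - (f (\val t) - f (l%:R * h)) by apply/rowP => k; rewrite !mxE; ring.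
have n1 := ler_normB ((path w t - v) + (v - f (l%:R * h))) (f (\val t) - f (l%:R * h)).
have n2 := ler_normD (path w t - v) (v - f (l%:R * h)).
have : h * (3 * C + 1) = C * (2 * h) + C * h + h by ring.
lra.
Qed.

Lemma process_support (i0 : E) (x : 'rV[R]_d) (eta : cpath R d) :
  M x -> {ae P, forall w, (Z time0 w).1 = x} ->
  (forall A, open A -> A eta -> (0 < P (path @^-1` A))%E) <->
  inclusion_solutions F x eta.
Proof.
move=> Mx X0.
have Z0 w : (Z time0 w).1 = (Zt 0%N w).1.
  rewrite -(path_of_switch C_ge0 F_le F_flow N_poisson Zt_chain Z_interpolates w 0).
  by rewrite (jump_time0 N_poisson) extend_path0.
have X0' : {ae P, forall w, (Zt 0%N w).1 = x}.
  have [Nu [mN N0 XN]] := X0; exists Nu; split => // w nw; apply: XN => /= X0w.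
  by apply: nw; rewrite /= -Z0.
split=> [supp|seta A oA Aeta]; last exact: solution_in_support seta oA Aeta.
apply: contrapT => neta.
have oS : open (~` @inclusion_solutions R d E F x).
  by apply: closed_openC; exact: (inclusion_solutions_closed i0 C_ge0 F_le).
have := supp _ oS neta.
suff -> : P (path @^-1` ~` @inclusion_solutions R d E F x) = 0%E by rewrite ltxx.
(* Only the initial condition may fail, and this on a null event: every path satisfies the inclusion
   itself. *)
have [Nu [mN N0 XN]] := X0.
apply/eqP; rewrite eq_le measure_ge0 andbT -N0; apply: le_measure; rewrite ?inE//.
  rewrite -[X in measurable X]setTI.
  apply: (measurable_path_of C_ge0 F_le F_smooth F_bounded F_flow N_poisson Zt_chain
    Z_interpolates) => //.
  exact: sub_sigma_algebra.
move=> w nw; apply: XN => /= X0w; apply: nw; apply/inclusion_solutionsP; split => //.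
exact: path_of_solution.
Qed.

End following.

Theorem theorem3p4 (R : realType) (d : nat) (d_gt0 : (0 < d)%N) (E : finType)
    (F : E -> 'rV[R]_d -> 'rV[R]_d) (Phi : E -> R -> 'rV[R]_d -> 'rV[R]_d)
    (F_smooth : forall i, smooth (F i))
    (F_bounded : forall i, bounded_fun (F i))
    (F_flow : forall i, is_flow (F i) (Phi i))
    (M : set 'rV[R]_d) (M_compact : compact M)
    (M_invariant : forall i t x, 0 <= t -> M x -> M (Phi i t x))
    (rate : 'rV[R]_d -> E -> E -> R)
    (rate_continuous : forall i j, {within M, continuous (fun x => rate x i j)})
    (rate_ge0 : forall x i j, M x -> i != j -> 0 <= rate x i j)
    (rate_diag : forall x i, M x -> rate x i i = 0)
    (rate_irreducible : forall x, M x -> irreducible (rate x))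
    (lam : R)
    (lam_gt : forall x i, M x -> \sum_(j | j != i) rate x i j < lam)
    (disp : measure_display) (Omega : measurableType disp)
    (P : probability Omega R)
    (N : time R -> Omega -> nat) (T : nat -> Omega -> R)
    (N_poisson : poisson_process P lam N T)
    (Zt : nat -> Omega -> 'rV[R]_d * E)
    (Zt_chain : embedded_chain P Phi M (jump_prob rate lam) N T Zt)
    (Z : time R -> Omega -> 'rV[R]_d * E)
    (Z_interpolates : interpolates Phi T Zt Z)
    (x : 'rV[R]_d) (Mx : M x)
    (X0 : {ae P, forall w, (Z time0 w).1 = x}) :
  exists X : {RV P >-> borel_cpath R d},
    (forall w t, (X w : cpath R d) t = (Z t w).1) /\
    measure_support (distribution P X : set (cpath R d) -> \bar R) =
      inclusion_solutions F x.
Proof.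
have [C C_ge0 F_le] : exists2 C, 0 <= C & forall i x, `|F i x| <= C.
  have : forall i, exists C, 0 <= C /\ forall x, `|F i x| <= C.
    by move=> i; have [C C0 FC] := bounded_fun_norm_le (F_bounded i); exists C.
  move=> /choice[C hC]; exists (\sum_i C i) => [|i y].
    by apply: sumr_ge0 => i _; case: (hC i).
  rewrite (le_trans ((hC i).2 y))// (bigD1 i)//= lerDl.
  by apply: sumr_ge0 => j _; case: (hC j).
(* A probability space is not empty, and the initial state of any outcome carries a mode. *)
have [i0 _] : exists i : E, True.
  apply: contrapT => noE.
  have : P setT = 0%E.
    rewrite (_ : setT = set0) ?measure0//; apply/seteqP; split => // w _.
    by apply: noE; exists (Zt 0%N w).2.
  by rewrite probability_setT => /eqP; rewrite onee_eq0.
pose path : Omega -> borel_cpath R d :=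
  path_of C_ge0 F_le F_flow N_poisson Zt_chain Z_interpolates.
have mpath : measurable_fun setT path.
  exact: (measurable_path_of C_ge0 F_le F_smooth F_bounded F_flow N_poisson Zt_chain
    Z_interpolates).
pose X : {RV P >-> borel_cpath R d} := mfun_Sub (mem_set mpath).
exists X; split => [w t|].
  by rewrite /X mfun_valP.
have supportP eta := process_support C_ge0 F_le F_smooth F_bounded F_flow M_compact
  M_invariant rate_continuous rate_ge0 rate_diag rate_irreducible lam_gt N_poisson
  Zt_chain Z_interpolates i0 eta Mx X0.
apply/seteqP; split => eta.
  by move=> supp; apply/supportP => A oA Aeta; exact: supp.
by move=> /supportP supp A oA Aeta; exact: supp.
Qed.
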